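(* Let $K$ be an algebraically closed field of characteristic $2$, let $n>1$ be an odd integer, and let $c\in K$ be transcendental over $\mathbb{F}_2$. Then the Hilbert series of the graded space $\mathcal{L}_{1,c}$ attached to $S_n$ (parameter $t=1$) is $$h_{\mathcal{L}_{1,c}}(z)=\left(1+z^2\right)(1+z)^{n-1}\left(1+(n-2)z^2+z^4\right),$$ or alternatively $$h_{\mathcal{L}_{1,c}}(z)=(1+z)^{n-1}\left(1+(n-1)z^2+(n-1)z^4+z^6\right).$$
   Context: Let $A=K[x_1,\dots,x_n]/(x_1+\dots+x_n)$ (this is $S\mathfrak{h}^*$, the underlying space of the polynomial/Verma module $\mathcal{M}_{t,c}$ of the rational Cherednik algebra of type $A_{n-1}$), graded by $\deg x_i=1$. The group $S_n$ acts by permuting the $x_i$; $\sigma_{ij}$ denotes the transposition of $i$ and $j$. For $t,c\in K$ put, on $K[x_1,\dots,x_n]$, $$D_{y_i}=t\,\partial_{x_i}-c\sum_{k\neq i}\frac{1-\sigma_{ik}}{x_i-x_k},\qquad D_{y_i-y_j}=D_{y_i}-D_{y_j}.$$ The Dunkl operators $D_{y_i-y_j}$ commute with each other and descend to operators on $A$. Let $\mathfrak{h}=\mathrm{Span}_K\{y_i-y_j\}$ (inside the $n$-dimensional space with basis $y_1,\dots,y_n$) and let $S\mathfrak{h}$ be its symmetric algebra; the assignment $y_i-y_j\mapsto D_{y_i-y_j}$ extends to an algebra homomorphism $S\mathfrak{h}\to \mathrm{End}(A)$, $f\mapsto f(D)$. The contravariant form is $\mathcal{B}:S\mathfrak{h}\times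 A\to K$, $\mathcal{B}(f,q)=$ the constant (degree $0$) term of $f(D)q$. Its kernel is $\ker\mathcal{B}=\{q\in A:\mathcal{B}(f,q)=0\ \forall f\in S\mathfrak{h}\}$, a graded ideal of $A$ stable under the Dunkl operators, and $\mathcal{L}_{t,c}=A/\ker\mathcal{B}$ with the inherited grading. The Hilbert series of a graded space $M$ is $h_M(z)=\sum_{i\ge 0}\dim_K M[i]\,z^i$, where $M[i]$ is the degree-$i$ component. *)

(* Defs.v *)
From HB Require Import structures.
From mathcomp Require Import all_boot all_order perm all_algebra finfield.
From mathcomp Require Import boolp.
From mathcomp.multinomials Require Import ssrcomplements mpoly.

Set Implicit Arguments.
Unset Strict Implicit.
Unset Printing Implicit Defensive.

Import GRing.Theory.
Local Open Scope ring_scope.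
Local Open Scope quotient_scope.

Section LinearQuotient.
Variables (K : fieldType) (V : lmodType K) (W : submodClosed V).

Definition lquot_pred : {pred V} := W.
Lemma lquot_pred_zmod_closed : zmod_closed lquot_pred.
Proof.
split=> [|u v Wu Wv]; first exact: (rpred0 W).
by rewrite -scaleN1r; apply: (@rpredD _ W) => //; apply: (@rpredZ _ _ W).
Qed.
HB.instance Definition _ :=
  GRing.isZmodClosed.Build V lquot_pred lquot_pred_zmod_closed.

Definition lquot : Type := Quotient.quot lquot_pred.
HB.instance Definition _ := GRing.Zmodule.on lquot.
HB.instance Definition _ := EqQuotient.on lquot.

Definition lpi (v : V) : lquot := \pi_(Quotient.quot lquot_pred) v.

Lemma lpi_eq u v : (lpi u = lpi v) <-> (u - v \in W).
Proof.
split=> [/eqP|]; first by rewrite -Quotient.idealrBE.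
by move=> h; apply/eqP; rewrite -Quotient.idealrBE.
Qed.

Lemma lpi_is_zmod_morphism : zmod_morphism lpi.
Proof. by move=> u v; rewrite /lpi raddfB. Qed.
HB.instance Definition _ :=
  GRing.isZmodMorphism.Build V lquot lpi lpi_is_zmod_morphism.

Lemma lpi_repr (q : lquot) : lpi (repr q) = q.
Proof. exact: reprK. Qed.

Definition lquot_scale (a : K) (q : lquot) : lquot := lpi (a *: repr q).

Lemma lquot_scaleE a v : lquot_scale a (lpi v) = lpi (a *: v).
Proof.
by apply/lpi_eq; rewrite -scalerBr rpredZ //; apply/lpi_eq; rewrite lpi_repr.
Qed.

Lemma lquot_scaleA a b q :
  lquot_scale a (lquot_scale b q) = lquot_scale (a * b) q.
Proof. by rewrite -[q]lpi_repr !lquot_scaleE scalerA. Qed.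

Lemma lquot_scale1 : left_id 1 lquot_scale.
Proof. by move=> q; rewrite -[q]lpi_repr lquot_scaleE scale1r. Qed.

Lemma lquot_scaleDr : right_distributive lquot_scale +%R.
Proof.
move=> a p q; rewrite -[p]lpi_repr -[q]lpi_repr -raddfD !lquot_scaleE.
by rewrite scalerDr raddfD.
Qed.

Lemma lquot_scaleDl q : {morph lquot_scale^~ q : a b / a + b}.
Proof. by move=> a b; rewrite -[q]lpi_repr !lquot_scaleE scalerDl raddfD. Qed.

HB.instance Definition _ := GRing.Zmodule_isLmodule.Build K lquot
  lquot_scaleA lquot_scale1 lquot_scaleDr lquot_scaleDl.

Lemma lpi_is_scalable : scalable lpi.
Proof. by move=> a v; rewrite -lquot_scaleE. Qed.
HB.instance Definition _ :=
  GRing.isScalable.Build K V lquot *:%R lpi lpi_is_scalable.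

End LinearQuotient.

Section Hilbert.
Variables (K : fieldType) (V : lmodType K).

Definition has_dim (W : V -> Prop) (d : nat) : Prop :=
  exists e : 'I_d -> V,
    [/\ forall k, W (e k),
        forall a : 'I_d -> K, \sum_k a k *: e k = 0 -> forall k, a k = 0
      & forall v, W v -> exists a : 'I_d -> K, v = \sum_k a k *: e k].

(* In particular every component must have finite dimension. *)
Definition is_hilbert_series (M : nat -> V -> Prop) (h : {poly int}) : Prop :=
  forall i, exists2 d : nat, has_dim (M i) d & h`_i = d%:Z.

End Hilbert.

Section Dunkl.
Variables (K : fieldType) (n : nat).
Local Notation P := {mpoly K[n]}.

Lemma divdiff_subproof (i k : 'I_n) (p : P) :
  exists q : P, ('X_i - 'X_k) * q == p - msym (tperm i k) p.
Proof.
pose D p := exists q : P, ('X_i - 'X_k) * q == p - msym (tperm i k) p.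
have D1 : D 1 by exists 0; rewrite msym1 subrr mulr0.
have DM p1 p2 : D p1 -> D p2 -> D (p1 * p2).
  move=> [q1 /eqP h1] [q2 /eqP h2].
  exists (q1 * p2 + msym (tperm i k) p1 * q2); apply/eqP.
  rewrite mulrDr mulrA h1 mulrCA h2 msymM mulrBl mulrBr.
  by rewrite addrA subrK.
have DX j : D 'X_j.
  rewrite /D; have -> : msym (tperm i k) 'X_j = 'X_(tperm i k j) :> P.
    by rewrite /msym mmapX mmap1U.
  case: tpermP => [->|->|_ _].
  - by exists 1; rewrite mulr1.
  - by exists (-1); rewrite mulrN1 opprB.
  - by exists 0; rewrite mulr0 subrr.
elim/mpolyind: p => [|a m p _ _ [q /eqP hq]].
  by exists 0; rewrite raddf0 subrr mulr0.
have [r /eqP hr] : D 'X_[m].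
  rewrite mpolyXE_id; apply: big_ind => // j _.
  by elim: (m j) => [//|e IHe]; rewrite exprS; apply: DM.
exists (a *: r + q); apply/eqP.
by rewrite mulrDr -scalerAr hr hq msymD msymZ scalerBr opprD addrACA.
Qed.

(* (p - sigma_ik p) / (x_i - x_k); arbitrary when i = k *)
Definition divdiff (i k : 'I_n) (p : P) : P := xchoose (divdiff_subproof i k p).

Lemma divdiffE i k p :
  ('X_i - 'X_k) * divdiff i k p = p - msym (tperm i k) p.
Proof. exact/eqP/(xchooseP (divdiff_subproof i k p)). Qed.

Lemma X_neq (i k : 'I_n) : k != i -> 'X_i - 'X_k != 0 :> P.
Proof.
move=> neq; apply/eqP => /mpolyP /(_ U_(i)%MM) /eqP.
by rewrite mcoeffB !mcoeffXU eqxx (negPf neq) subr0 mcoeff0 oner_eq0.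
Qed.

Lemma divdiff_uniq i k p q : k != i ->
  ('X_i - 'X_k) * q = p - msym (tperm i k) p -> q = divdiff i k p.
Proof. by move=> neq h; apply: (mulfI (X_neq neq)); rewrite divdiffE. Qed.

Variables (t c : K).

Definition dunkl (i : 'I_n) (p : P) : P :=
  t *: p^`M(i) - c *: \sum_(k | k != i) divdiff i k p.

Definition dunklv (v : 'rV[K]_n) (p : P) : P := \sum_i v 0 i *: dunkl i p.

Lemma dunkl_is_linear i : linear (dunkl i).
Proof.
move=> a p q; rewrite /dunkl mderivD mderivZ.
have -> : \sum_(k | k != i) divdiff i k (a *: p + q) =
   a *: (\sum_(k | k != i) divdiff i k p) + \sum_(k | k != i) divdiff i k q.
  rewrite scaler_sumr -big_split /=; apply: eq_bigr => k neq; apply/esym.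
  apply: (divdiff_uniq neq); rewrite mulrDr -scalerAr !divdiffE.
  by rewrite msymD msymZ scalerBr opprD addrACA.
by rewrite scalerBr !scalerDr !scalerA (mulrC t) (mulrC c) opprD addrACA.
Qed.
HB.instance Definition _ i :=
  GRing.isLinear.Build K P P *:%R (dunkl i) (dunkl_is_linear i).

Lemma dunklv_is_linear v : linear (dunklv v).
Proof.
move=> a p q; rewrite /dunklv scaler_sumr -big_split /=.
by apply: eq_bigr => i _; rewrite dunkl_is_linear scalerDr !scalerA (mulrC _ a).
Qed.
HB.instance Definition _ v :=
  GRing.isLinear.Build K P P *:%R (dunklv v) (dunklv_is_linear v).

Definition sumX : P := \sum_(i < n) 'X_i.

Definition sumX_ideal : {pred P} := fun p => `[< exists q, p = q * sumX >].

Lemma sumX_ideal_submod : submod_closed sumX_ideal.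
Proof.
split=> [|a p q /asboolP[p' ->] /asboolP[q' ->]]; apply/asboolP.
  by exists 0; rewrite mul0r.
by exists (a *: p' + q'); rewrite mulrDl -scalerAl.
Qed.
HB.instance Definition _ :=
  GRing.isSubmodClosed.Build K P sumX_ideal sumX_ideal_submod.

(* Only the vector space structure of A = K[x]/(x_1 + ... + x_n) is needed. *)
Definition polyA : lmodType K := lquot sumX_ideal.

Definition piA (p : P) : polyA := lpi sumX_ideal p.

Lemma piA_linear : linear piA.
Proof. by move=> a p q; rewrite /piA linearP. Qed.
HB.instance Definition _ :=
  GRing.isLinear.Build K P polyA *:%R piA piA_linear.

Lemma piA_repr (a : polyA) : piA (repr a) = a.
Proof. exact: lpi_repr. Qed.

Definition degA (i : nat) (a : polyA) : Prop :=
  exists2 p : P, p \is i.-homog & a = piA p.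

Definition yv (i : 'I_n) : 'rV[K]_n := delta_mx 0 i.

Definition hspace : {vspace 'rV[K]_n} :=
  <<[seq yv ij.1 - yv ij.2 | ij : 'I_n * 'I_n]>>%VS.

Lemma dunkl_sumX i q : dunkl i (q * sumX) = dunkl i q * sumX + t *: q.
Proof.
have dX : sumX^`M(i) = 1.
  rewrite /sumX linear_sum /= (bigD1 i) //= mderivX mnm1E eqxx scale1r.
  have -> : (U_(i) - U_(i) = 0 :> 'X_{1..n})%MM.
    by apply/mnmP => j; rewrite mnmBE subnn mnm0E.
  rewrite mpolyX0 big1 ?addr0 // => k neq.
  by rewrite mderivX mnm1E (negPf neq) scale0r.
have sX s : msym s sumX = sumX.
  rewrite /sumX raddf_sum /= [RHS](reindex_inj (@perm_inj _ s)) /=.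
  by apply: eq_bigr => k _; rewrite /msym mmapX mmap1U.
rewrite /dunkl mderivM dX mulr1 scalerDr mulrBl -!scalerAl.
rewrite addrAC; congr (_ - _ *: _ + _); rewrite mulr_suml; apply: eq_bigr => k neq.
by apply/esym/divdiff_uniq; rewrite // mulrA divdiffE msymM sX mulrBl.
Qed.

Lemma hspace_sum0 v : v \in hspace -> \sum_i v 0 i = 0.
Proof.
have sy j : \sum_i yv j 0 i = 1.
  rewrite (bigD1 j) //= mxE !eqxx big1 ?addr0 // => i neq.
  by rewrite mxE (negPf neq) andbF.
move=> /coord_span ->; under eq_bigr do rewrite summxE.
rewrite exchange_big big1 //= => k _.
under eq_bigr do rewrite mxE.
rewrite -mulr_sumr.
set X := image_tuple _ _.
have /imageP[ij _ ->] : X`_k \in X by apply: mem_nth; rewrite size_tuple.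
under eq_bigr do rewrite mxE [X in _ + X]mxE.
by rewrite big_split /= sumrN !sy subrr mulr0.
Qed.

(* Well defined on classes for v in hspace only, see dunklA_pi. *)
Definition dunklA (v : 'rV[K]_n) (a : polyA) : polyA := piA (dunklv v (repr a)).

Lemma dunklA_pi v p : v \in hspace -> dunklA v (piA p) = piA (dunklv v p).
Proof.
move=> /hspace_sum0 v0; apply/lpi_eq; rewrite -raddfB.
have /asboolP[q ->] : repr (piA p) - p \in sumX_ideal.
  by apply/lpi_eq; rewrite lpi_repr.
apply/asboolP; exists (dunklv v q); rewrite /= /dunklv mulr_suml.
under eq_bigr do rewrite dunkl_sumX scalerDr scalerAl.
by rewrite big_split /= -scaler_suml v0 scale0r addr0.
Qed.

Lemma dunklA_linear v : v \in hspace -> linear (dunklA v).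
Proof.
move=> hv a p q; rewrite -[p]piA_repr -[q]piA_repr -piA_linear.
by rewrite !(dunklA_pi _ hv) dunklv_is_linear piA_linear.
Qed.

Definition const_term (a : polyA) : K := (repr a)@_0%MM.

Lemma const_term_pi p : const_term (piA p) = p@_0%MM.
Proof.
have /asboolP[q /eqP] : repr (piA p) - p \in sumX_ideal.
  by apply/lpi_eq; rewrite lpi_repr.
rewrite subr_eq => /eqP h; rewrite /const_term h mcoeffD.
rewrite (mcoeff0_is_multiplicative n K).1 /sumX raddf_sum big1.
  by rewrite mulr0 add0r.
move=> i _ /=.
by rewrite mcoeffX mnm1_eq0.
Qed.

Lemma const_term_linear : linear_for *%R const_term.
Proof.
move=> a p q; rewrite -[p]piA_repr -[q]piA_repr -piA_linear !const_term_pi.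
by rewrite mcoeffD mcoeffZ.
Qed.

(* The symmetric algebra S h, as polynomials in the basis vbasis hspace of h. *)
Local Notation d := (\dim hspace).
Local Notation symh := {mpoly K[d]}.

Definition symh_of (v : 'rV[K]_n) : symh :=
  \sum_k coord (vbasis hspace) k v *: 'X_k.

Definition monom_act (m : 'X_{1..d}) (a : polyA) : polyA :=
  foldr (fun k => iter (m k) (dunklA (vbasis hspace)`_k)) a
    (enum 'I_d).

(* f(D); the Dunkl operators commute, so the order of the factors in
   monom_act is immaterial. *)
Definition symh_act (f : symh) (a : polyA) : polyA :=
  \sum_(m <- msupp f) f@_m *: monom_act m a.

Lemma monom_act_linear m : linear (monom_act m).
Proof.
rewrite /monom_act; elim: (enum _) => [//|k s IHs] a p q /=.
rewrite IHs; elim: (m k) => [//|j IHj]; rewrite !iterS IHj.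
by apply/dunklA_linear/vbasis_mem/mem_nth; rewrite size_tuple.
Qed.

Lemma symh_act_linear f : linear (symh_act f).
Proof.
move=> a p q; rewrite /symh_act scaler_sumr -big_split; apply: eq_bigr => m _.
by rewrite monom_act_linear scalerDr !scalerA (mulrC a).
Qed.

Lemma symh_act_wE N (f : symh) a : (msize f <= N)%N ->
  symh_act f a = \sum_(m : 'X_{1..d < N}) f@_m *: monom_act m a.
Proof.
move=> leN; pose I := 'X_{1..d < N}.
rewrite /symh_act (big_mksub I) //=; first last.
- by move=> m /msize_mdeg_lt /leq_trans; apply.
- exact: msupp_uniq.
by rewrite big_rmcond //= => m /memN_msupp_eq0 ->; rewrite scale0r.
Qed.

Lemma symh_act_linearl a : linear (symh_act^~ a).
Proof.
move=> b f g; pose N := maxn (msize (b *: f + g)) (maxn (msize f) (msize g)).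
rewrite !(@symh_act_wE N) /N ?leq_max ?leqnn ?orbT //.
rewrite scaler_sumr -big_split; apply: eq_bigr => m _ /=.
by rewrite mcoeffD mcoeffZ scalerDl scalerA.
Qed.

Lemma symh_act_of v a : v \in hspace -> symh_act (symh_of v) a = dunklA v a.
Proof.
move=> hv; have actX k : symh_act 'X_k a = dunklA (vbasis hspace)`_k a.
  rewrite /symh_act msuppX big_seq1 mcoeffX eqxx scale1r /monom_act.
  have : k \in enum 'I_d by rewrite mem_enum.
  elim: (enum _) (enum_uniq 'I_d) => //= j s IHs /andP[js us].
  have id0 s' : k \notin s' ->
      foldr (fun j => iter (U_(k)%MM j) (dunklA (vbasis hspace)`_j)) a s' = a.
    elim: s' => //= j' s' IH'; rewrite inE negb_or => /andP[kj /IH' ->].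
    by rewrite mnm1E (negPf kj).
  rewrite inE mnm1E; have [kj _|/= kj ks] := eqVneq k j; last exact: IHs.
  by rewrite id0 kj.
have act0 : symh_act 0 a = 0 by rewrite /symh_act msupp0 big_nil.
have D0 : dunklA 0 a = 0.
  by rewrite /dunklA /dunklv big1 ?raddf0 // => i _; rewrite mxE scale0r.
have DL b u w : dunklA (b *: u + w) a = b *: dunklA u a + dunklA w a.
  rewrite /dunklA -piA_linear /dunklv; congr piA.
  rewrite scaler_sumr -big_split; apply: eq_bigr => i _ /=.
  by rewrite !mxE scalerDl scalerA.
rewrite {2}(coord_vbasis hv) /symh_of.
elim/big_rec2: _ => [|k u f _ IH]; first by rewrite act0 D0.
by rewrite symh_act_linearl actX DL IH.
Qed.

Definition cform (f : symh) (a : polyA) : K :=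
  const_term (symh_act f a).

Definition ker_cform : {pred polyA} := fun a => `[< forall f, cform f a = 0 >].

Lemma ker_cform_submod : subsemimod_closed ker_cform.
Proof.
have ker_linear a p q :
    p \in ker_cform -> q \in ker_cform -> a *: p + q \in ker_cform.
  move=> /asboolP hp /asboolP hq; apply/asboolP => f.
  rewrite /cform symh_act_linear const_term_linear.
  by move: (hp f) (hq f); rewrite /cform => -> ->; rewrite mulr0 addr0.
have ker0 : 0 \in ker_cform.
  apply/asboolP => f; rewrite /cform.
  have -> : symh_act f 0 = 0.
    by have := symh_act_linear f (-1) 0 0; rewrite scaler0 addr0 scaleN1r addNr.
  by rewrite -(raddf0 piA) const_term_pi mcoeff0.
split; [split=> // p q hp hq | move=> a p hp].
  by rewrite -[p]scale1r ker_linear.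
by rewrite -[_ *: _]addr0 ker_linear.
Qed.
HB.instance Definition _ :=
  GRing.isSubmodClosed.Build K polyA ker_cform ker_cform_submod.

Definition modL : lmodType K := lquot ker_cform.

Definition degL (i : nat) (x : modL) : Prop :=
  exists2 a : polyA, degA i a & x = lpi ker_cform a.

End Dunkl.

(* Main.v *)
Require Import Defs.
From HB Require Import structures.
From mathcomp Require Import all_boot all_order all_fingroup all_algebra.
From mathcomp Require Import finfield.
From mathcomp Require Import boolp ring.
From mathcomp.multinomials Require Import mpoly.

Set Implicit Arguments.
Unset Strict Implicit.
Unset Printing Implicit Defensive.

Import GRing.Theory.
Local Open Scope ring_scope.

(** The quotient L is shown to have an explicit basis. Fix an index z. The basis
    consists of the products of a square-free monomial in the n - 1 variables
    x_a, a != z, and of g(x_1^2, ..., x_n^2), where g is one of the 2n core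
    monomials 1, x_a, x_a^2 (a != z) and x_i1^2 x_i2. The core monomials form a
    basis of the analogous quotient for t = 0, with Hilbert series
    1 + (n-1) X + (n-1) X^2 + X^3, so that the number of basis monomials in each
    degree is the coefficient of the announced series (coef_basis_count). Both
    halves of the argument treat c as a deformation parameter near c = 0: a
    matrix over F_2[c] that is invertible at c = 0 has a nonzero polynomial as
    its determinant, and so stays invertible at a transcendental c
    (left_inverse_transcendental).

    The basis spans (homog_spanned). Since n is odd, the elements x_i + s, with
    s the sum of the variables, sum to zero in the polynomial ring, and the
    Dunkl operators can be computed there. This gives explicit vectors of degree
    4 that are killed by all Dunkl operators (dunkl_singular_quartic); so is
    the square of the sum of the cubes. The ideal that they generate with s is
    stable under the Dunkl operators of h and therefore lies in the kernel of
    the form (kernel_ideal_ker). At c = 0 the quartics become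
    A_a^2 + A_a A_b + A_b^2 with A_a = x_a^2, and modulo these relations every
    monomial reduces to a sum of basis monomials (near_spanX). Hence modulo the
    kernel every monomial is a combination of basis monomials plus c times a
    combination of monomials of the same degree over F_2[c], and a matrix that
    is the identity at c = 0 has to be inverted.

    The basis is independent modulo the kernel (basis_independent). The Dunkl
    operator D_a of y_a - y_z is the sum of a derivation and of c times an
    operator drefl a, the Dunkl operator of the same vector with t = 0 and
    c = 1. In characteristic two the derivation squares to zero, so that D_a^2
    is divisible by c; on squares one finds D_a^2 (p^2) = c (drefl a p)^2 modulo
    c^2 (dderiv_drefl_sqr, ddunkl2_sqr). The form is evaluated on the basis
    against products of D_a, a in S, and of D_b^2, b in a word that is dual to a
    core monomial for t = 0. After division by powers of c, the resulting matrix
    is unitriangular at c = 0 with respect to the size of the square-free part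
    (pairing_expansion). The factors may be applied in any order because the
    Dunkl operators commute (dunklC). *)

(** * Divided differences and commutation of the Dunkl operators *)

Section Dunkl.
Variables (K : fieldType) (n : nat).
Local Notation P := {mpoly K[n]}.
Implicit Types (p q : P) (i j k l : 'I_n) (w : 'S_n).

(** Operators are compared on 1 and along multiplication by a variable. *)
Lemma mpoly_ind_XM (Q : P -> Prop) :
  (forall a p q, Q p -> Q q -> Q (a *: p + q)) -> Q 0 -> Q 1 ->
  (forall i p, Q p -> Q ('X_i * p)) -> forall p, Q p.
Proof.
move=> QD Q0 Q1 QX; elim/mpolyind => // a m p _ _ Qp; apply: (QD) => //.
rewrite mpolyXE_id; elim/big_rec: _ => // i q _ Qq.
by elim: (m i) => [|e IHe]; rewrite ?mul1r // exprS -mulrA; apply: QX.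
Qed.

Lemma msymXi w i : msym w 'X_i = 'X_(w i) :> P.
Proof. by rewrite /msym mmapX mmap1U. Qed.

Lemma divdiff_eq i k p q : k != i ->
  ('X_i - 'X_k) * q = p - msym (tperm i k) p -> divdiff i k p = q.
Proof. by move=> neq /(divdiff_uniq neq). Qed.

Lemma divdiffZ i k a p : k != i -> divdiff i k (a *: p) = a *: divdiff i k p.
Proof.
by move=> neq; apply: divdiff_eq; rewrite // -scalerAr divdiffE msymZ scalerBr.
Qed.

Lemma divdiff_sum i k (I : Type) (r : seq I) (A : pred I) (F : I -> P) :
  k != i -> divdiff i k (\sum_(j <- r | A j) F j) =
            \sum_(j <- r | A j) divdiff i k (F j).
Proof.
move=> neq; apply: divdiff_eq => //.
rewrite mulr_sumr [msym _ _]raddf_sum -sumrB; apply: eq_bigr => j _.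
exact: divdiffE.
Qed.

Lemma divdiffM i k p q : k != i -> divdiff i k (p * q) =
  p * divdiff i k q + divdiff i k p * msym (tperm i k) q.
Proof.
move=> neq; apply: divdiff_eq => //.
rewrite mulrDr mulrCA (divdiffE i k q) mulrA (divdiffE i k p).
by rewrite msymM mulrBr mulrBl addrA subrK.
Qed.

Lemma divdiff_sym i k p : k != i -> msym (tperm i k) p = p -> divdiff i k p = 0.
Proof. by move=> neq e; apply: divdiff_eq; rewrite // e subrr mulr0. Qed.

Lemma divdiffXi i k j : k != i ->
  divdiff i k 'X_j = ((j == i)%:R - (j == k)%:R) :> P.
Proof.
move=> neq; apply: divdiff_eq; rewrite // msymXi.
case: tpermP => [->|->|/eqP/negPf -> /eqP/negPf ->]; last by rewrite !subrr mulr0.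
- by rewrite eqxx eq_sym (negPf neq) subr0 mulr1.
- by rewrite eqxx (negPf neq) sub0r mulrN1 opprB.
Qed.

Lemma divdiffC i k p : k != i -> divdiff k i p = - divdiff i k p.
Proof.
move=> neq; apply: divdiff_eq; first by rewrite eq_sym.
by rewrite mulrN -mulNr opprB divdiffE tpermC.
Qed.

Lemma msym_divdiff w i k p : k != i ->
  msym w (divdiff i k p) = divdiff (w i) (w k) (msym w p).
Proof.
move=> neq; apply/esym/divdiff_eq; first by rewrite (inj_eq perm_inj).
rewrite -!msymXi -msymB -msymM divdiffE msymB; congr (_ - _).
by rewrite -!msymMm -tpermJ -conjgC.
Qed.

Lemma mderivXi i j : 'X_j^`M(i) = (j == i)%:R :> P.
Proof.
rewrite mderivX mnm1E; case: eqP => [->|]; last by rewrite scale0r.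
have -> : (U_(i) - U_(i) = 0 :> 'X_{1..n})%MM.
  by apply/mnmP => k; rewrite mnmBE subnn mnm0E.
by rewrite mpolyX0 scale1r.
Qed.

Lemma msym_mderiv w i p : msym w p^`M(i) = (msym w p)^`M(w i).
Proof.
elim/mpoly_ind_XM: p => [a p q IHp IHq|||j p IHp].
- by rewrite mderivD mderivZ !msymD !msymZ mderivD mderivZ IHp IHq.
- by rewrite !msym0 !mderiv0 msym0.
- by rewrite msym1 -mpolyC1 !mderivC msym0.
rewrite msymM !mderivM msymD !msymM IHp msymXi !mderivXi (inj_eq perm_inj).
by rewrite rmorph_nat.
Qed.

Lemma msym_sumX w : msym w (sumX K n) = sumX K n.
Proof.
rewrite /sumX raddf_sum /= [RHS](reindex_inj (@perm_inj _ w)) /=.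
by apply: eq_bigr => j _; rewrite msymXi.
Qed.

Section Commutation.
Variables (t c : K) (D : 'I_n -> {linear P -> P}).

(** The commutator of a Dunkl operator with multiplication by a variable,
    as in the defining relations of the rational Cherednik algebra. *)
Definition commX i k p : P :=
  ((k == i)%:R * t) *: p -
  c *: \sum_(l | l != i) ((k == i)%:R - (k == l)%:R) * msym (tperm i l) p.

Lemma commX_neq i k p : k != i -> commX i k p = c *: msym (tperm i k) p.
Proof.
move=> neq; rewrite /commX (negPf neq) mul0r scale0r sub0r.
rewrite (bigD1 k) //= eqxx big1 => [|l /andP[_ ne]].
  by rewrite addr0 sub0r mulN1r scalerN opprK.
by rewrite eq_sym (negPf ne) subrr mul0r.
Qed.

Lemma commX_eq i p :
  commX i i p = t *: p - c *: \sum_(l | l != i) msym (tperm i l) p.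
Proof.
rewrite /commX eqxx mul1r; congr (_ - _ *: _).
by apply: eq_bigr => l; rewrite eq_sym => /negPf ->; rewrite subr0 mul1r.
Qed.

Hypothesis D1 : forall i, D i 1 = 0.
Hypothesis D_sym : forall w i p, msym w (D i p) = D (w i) (msym w p).
Hypothesis D_XM : forall i k p, D i ('X_k * p) = 'X_k * D i p + commX i k p.

(** Operators that satisfy the relations of the rational Cherednik algebra
    with the variables commute: by equivariance their commutator commutes with
    every variable, and it kills 1. *)
Lemma commuting_of_commX i j p : D i (D j p) = D j (D i p).
Proof.
have [->//|neq] := eqVneq i j.
(* The case where the variable is one of x_i and x_j. *)
have cross a b q : a != b ->
    commX a a (D b q) + D a (commX b a q) =
    commX b a (D a q) + D b (commX a a q).
  move=> ne; have ne' : b != a by rewrite eq_sym.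
  rewrite !(commX_neq _ ne) !commX_eq (linearB (D b)) !(linearZ_LR (D _)).
  rewrite (linear_sum (D b)).
  rewrite (bigD1 b) //= [X in _ = _ + (_ - c *: X)](bigD1 b) //=.
  rewrite !D_sym !tpermR (tpermC b a).
  rewrite (eq_bigr (fun l => D b (msym (tperm a l) q))) => [|l /andP[la lb]].
    move: (D a _) (D b (msym _ _)) (D b q) (\sum_(_ | _) _) => u v y S.
    by rewrite -!mul_mpolyC; ring.
  by rewrite D_sym tpermD // eq_sym.
elim/mpoly_ind_XM: p => [a p q IHp IHq|||k p IHp].
- by rewrite !linearP /= IHp IHq.
- by rewrite !linear0.
- by rewrite !D1 !linear0.
have XX a b : D a (D b ('X_k * p)) =
    'X_k * D a (D b p) + (commX a k (D b p) + D a (commX b k p)).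
  by rewrite (D_XM b k p) (linearD (D a)) (D_XM a k (D b p)) -addrA.
suff E : commX i k (D j p) + D i (commX j k p) =
    commX j k (D i p) + D j (commX i k p) by rewrite (XX i j) (XX j i) IHp;
  exact: (congr1 (fun q => 'X_k * D j (D i p) + q) E).
have [->|ki] := eqVneq k i; first exact: cross.
have [->|kj] := eqVneq k j; first by apply/esym/(cross j i p); rewrite eq_sym.
rewrite (commX_neq _ ki) (commX_neq _ kj) (commX_neq _ ki) (commX_neq _ kj).
rewrite !(linearZ_LR (D _)) (D_sym _ j) (D_sym _ i) addrC.
by rewrite !tpermD // eq_sym.
Qed.

End Commutation.

Section Commutation.
Variables t c : K.
Local Notation D := (@dunkl K n t c).
Lemma dunkl1 i : D i 1 = 0.
Proof.
rewrite /dunkl -mpolyC1 mderivC scaler0 big1 ?scaler0 ?subr0 // => k neq.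
by rewrite mpolyC1 divdiff_sym ?msym1.
Qed.

Lemma msym_dunkl w i p : msym w (D i p) = D (w i) (msym w p).
Proof.
rewrite /dunkl msymB !msymZ msym_mderiv.
rewrite [msym w (\sum_(_ | _) _)]raddf_sum /=; congr (_ - _ *: _).
rewrite [RHS](reindex_inj (@perm_inj _ w)) /=.
under [RHS]eq_bigl => k do rewrite (inj_eq perm_inj).
by apply: eq_bigr => k neq; rewrite msym_divdiff.
Qed.

Lemma dunklXM i k p : D i ('X_k * p) = 'X_k * D i p + commX t c i k p.
Proof.
rewrite /dunkl /commX mderivM mderivXi.
set S := (X in _ = _ + (_ - c *: X)).
rewrite [X in _ - c *: X = _](_ : _ = 'X_k * \sum_(l | l != i) divdiff i l p + S).
  move: (\sum_(l | l != i) divdiff i l p) S p^`M(i) => S1 S2 dp.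
  case: (k == i); rewrite /= ?mul1r ?mul0r ?scale0r -!mul_mpolyC; ring.
rewrite mulr_sumr -big_split; apply: eq_bigr => l neq.
by rewrite divdiffM // divdiffXi.
Qed.

Lemma dunklC i j p : D i (D j p) = D j (D i p).
Proof.
exact: (commuting_of_commX (D := D) dunkl1 msym_dunkl dunklXM).
Qed.

Lemma dunklvC u v p : dunklv t c u (dunklv t c v p) = dunklv t c v (dunklv t c u p).
Proof.
have E a b : dunklv t c a (dunklv t c b p) =
    \sum_i \sum_j (a 0 i * b 0 j) *: D i (D j p).
  rewrite /dunklv; apply: eq_bigr => i _; rewrite linear_sum scaler_sumr.
  by apply: eq_bigr => j _; rewrite linearZ scalerA.
rewrite (E u v); apply: (etrans _ (esym (E v u))).
rewrite exchange_big; apply: eq_bigr => i _; apply: eq_bigr => j _.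
by rewrite (dunklC j i) mulrC.
Qed.

End Commutation.
End Dunkl.

(** * The action of the symmetric algebra and the kernel of the form *)

Section CommutingIterates.
Variables (I : Type) (V : Type) (E : I -> V -> V).
Hypothesis EC : forall i j a, E i (E j a) = E j (E i a).

Lemma iter_commute i j k l a :
  iter k (E i) (iter l (E j) a) = iter l (E j) (iter k (E i) a).
Proof.
have h b : E i (iter l (E j) b) = iter l (E j) (E i b).
  by elim: l => //= l IHl; rewrite EC IHl.
by elim: k => //= k ->; rewrite h.
Qed.

Lemma foldr_iterD (m1 m2 : I -> nat) (s : seq I) a :
  foldr (fun i => iter (m1 i + m2 i) (E i)) a s =
  foldr (fun i => iter (m1 i) (E i)) (foldr (fun i => iter (m2 i) (E i)) a s) s.
Proof.
have push i k b : forall s', iter k (E i) (foldr (fun j => iter (m1 j) (E j)) b s')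
    = foldr (fun j => iter (m1 j) (E j)) (iter k (E i) b) s'.
  by elim=> //= j s' IHs; rewrite iter_commute IHs.
by elim: s => //= i s ->; rewrite iterD push.
Qed.
End CommutingIterates.

Section Form.
Variables (K : fieldType) (n : nat) (t c : K).
Local Notation P := {mpoly K[n]}.
Local Notation A := (polyA K n).
Local Notation h := (hspace K n).
Local Notation symh := {mpoly K[\dim h]}.
Implicit Types (p q : P) (a : A) (f g : symh).

Lemma piA_onto a : exists p, a = piA p.
Proof. by exists (generic_quotient.repr a); rewrite piA_repr. Qed.

Lemma dunklA_commute u v a : u \in h -> v \in h ->
  dunklA t c u (dunklA t c v a) = dunklA t c v (dunklA t c u a).
Proof.
move=> hu hv; have [p ->] := piA_onto a.
have E w w' : w \in h -> w' \in h ->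
    dunklA t c w (dunklA t c w' (piA p)) = piA (dunklv t c w (dunklv t c w' p)).
  by move=> hw hw'; rewrite (dunklA_pi _ _ _ hw') (dunklA_pi _ _ _ hw).
apply: (etrans (E _ _ hu hv)); apply: (etrans _ (esym (E _ _ hv hu))).
exact: (congr1 (@piA K n) (dunklvC t c u v p)).
Qed.

Lemma vbasis_h k : (vbasis h)`_k \in h.
Proof.
have [lt|ge] := ltnP k (size (vbasis h)); first exact/vbasis_mem/mem_nth.
by rewrite nth_default ?mem0v.
Qed.

Lemma monom_actD m1 m2 a :
  monom_act t c (m1 + m2)%MM a = monom_act t c m1 (monom_act t c m2 a).
Proof.
rewrite /monom_act -foldr_iterD => [|i j b]; last by rewrite dunklA_commute ?vbasis_h.
by elim: (enum _) => //= i s ->; rewrite mnmDE.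
Qed.

Lemma symh_actX m a : symh_act t c 'X_[m] a = monom_act t c m a.
Proof. by rewrite /symh_act msuppX big_seq1 mcoeffX eqxx scale1r. Qed.

Lemma symh_act0l a : symh_act t c 0 a = 0.
Proof. by rewrite /symh_act msupp0 big_nil. Qed.

Lemma monom_act0 m : monom_act t c m (0 : A) = 0.
Proof.
have := monom_act_linear t c m (-1) (0 : A) 0.
by rewrite scaler0 addr0 scaleN1r addNr.
Qed.

(** This makes the form computable on products of linear forms in any order,
    and is where the commutation of the Dunkl operators is needed. *)
Lemma symh_actM f g a :
  symh_act t c (f * g) a = symh_act t c f (symh_act t c g a).
Proof.
elim/mpolyind: f => [|b m f _ _ IHf]; first by rewrite mul0r !symh_act0l.
rewrite mulrDl -scalerAl !symh_act_linearl IHf; congr (_ *: _ + _).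
elim/mpolyind: g {IHf} => [|b' m' g _ _ IHg].
  by rewrite mulr0 !symh_act0l symh_actX monom_act0.
rewrite mulrDr -scalerAr !symh_act_linearl IHg !symh_actX monom_act_linear.
by rewrite -mpolyXD symh_actX monom_actD.
Qed.

Lemma symh_act1 a : symh_act t c 1 a = a.
Proof.
rewrite -mpolyX0 symh_actX /monom_act.
by elim: (enum _) => //= i s ->; rewrite mnm0E.
Qed.

Lemma symh_act_prod (s : seq 'rV[K]_n) p : {subset s <= h} ->
  symh_act t c (\prod_(v <- s) symh_of v) (piA p) = piA (foldr (dunklv t c) p s).
Proof.
elim: s => [|v s IHs] hs /=; first by rewrite big_nil symh_act1.
have hv : v \in h by apply: hs; rewrite inE eqxx.
rewrite big_cons symh_actM IHs => [|u us]; last by apply: hs; rewrite inE us orbT.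
exact: etrans (symh_act_of _ _ _ hv) (dunklA_pi _ _ _ hv).
Qed.

Lemma cform_prod (s : seq 'rV[K]_n) p : {subset s <= h} ->
  cform t c (\prod_(v <- s) symh_of v) (piA p) = (foldr (dunklv t c) p s)@_0%MM.
Proof. by move=> hs; rewrite /cform symh_act_prod // const_term_pi. Qed.

(** The form is read off in degree 0, so a space that is stable under the Dunkl
    operators of h and has no constant terms is orthogonal to all of S h. *)
Lemma ker_of_stable (Q : P -> Prop) :
  (forall p q, Q p -> Q q -> Q (p + q)) -> (forall (b : K) p, Q p -> Q (b *: p)) ->
  (forall v p, v \in h -> Q p -> Q (dunklv t c v p)) ->
  (forall p, Q p -> p@_0%MM = 0) ->
  forall p, Q p -> piA p \in ker_cform t c.
Proof.
move=> QD QZ Qdunkl Qc p Qp; apply/asboolP => f; rewrite /cform.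
have [q -> Qq] : exists2 q, symh_act t c f (piA p) = piA q & Q q; last first.
  by rewrite const_term_pi Qc.
have mQ m : exists2 q, monom_act t c m (piA p) = piA q & Q q.
  rewrite /monom_act; elim: (enum _) => [|k s [q /= -> Qq]]; first by exists p.
  elim: (m k) => [|j [q' IHj Qq']]; first by exists q.
  exists (dunklv t c (vbasis h)`_k q'); last exact: Qdunkl (vbasis_h k) Qq'.
  by rewrite iterS IHj dunklA_pi ?vbasis_h.
elim/mpolyind: f => [|b m f _ _ [q fq Qq]].
  by exists (0 *: p); [rewrite symh_act0l scale0r raddf0 | apply: QZ].
have [q' mq' Qq'] := mQ m; exists (b *: q' + q); last by apply: QD; [apply: QZ|].
by rewrite symh_act_linearl symh_actX mq' fq linearP.
Qed.

End Form.

(** * Specialization at a transcendental parameter *)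

Section Specialization.
Variables (F K : fieldType) (iota : {rmorphism F -> K}) (c : K).

(** Evaluation at c of polynomials over a subfield; it is injective when c is
    transcendental over that subfield. *)
Definition evc (r : {poly F}) : K := (map_poly iota r).[c].

Lemma evc_is_zmod_morphism : zmod_morphism evc.
Proof. by move=> r s; rewrite /evc rmorphB hornerD hornerN. Qed.
Lemma evc_is_monoid_morphism : monoid_morphism evc.
Proof. by split=> [|r s]; rewrite /evc ?rmorph1 ?hornerC // rmorphM hornerM. Qed.
HB.instance Definition _ :=
  GRing.isZmodMorphism.Build {poly F} K evc evc_is_zmod_morphism.
HB.instance Definition _ :=
  GRing.isMonoidMorphism.Build {poly F} K evc evc_is_monoid_morphism.

Lemma evcX : evc 'X = c.
Proof. by rewrite /evc map_polyX hornerX. Qed.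

Lemma evc_injective r : ~ algebraicOver iota c -> evc r = 0 -> r = 0.
Proof.
move=> ctr r0; apply/eqP/negP => /negP rN0; apply: ctr.
by exists r => //; apply/rootP.
Qed.

(** If a polynomial matrix is invertible at the parameter value 0, then its
    determinant is a nonzero polynomial, so that it stays invertible at any
    transcendental parameter. *)
Lemma left_inverse_transcendental (I : finType) (R : I -> I -> {poly F}) :
    ~ algebraicOver iota c ->
    (forall b : I -> F, (forall i, \sum_j (R i j).[0] * b j = 0) ->
       forall j, b j = 0) ->
  exists S : I -> I -> K,
    forall i k, \sum_j S i j * evc (R j k) = (i == k)%:R.
Proof.
move=> ctr Rinj.
pose M : 'M[{poly F}]_#|I| := \matrix_(a, b) R (enum_val a) (enum_val b).
have M0_unit : map_mx (horner_eval 0) M \in unitmx.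
  rewrite -unitmx_tr -row_free_unit; apply: inj_row_free => v /rowP Mv.
  apply/rowP => b; rewrite mxE -(enum_valK b).
  apply: (Rinj (fun j => v 0 (enum_rank j))) => i.
  have := Mv (enum_rank i); rewrite !mxE; apply: etrans.
  rewrite (reindex_onto enum_val enum_rank) /= => [|j _]; last exact: enum_rankK.
  apply: eq_big => [a|a _]; first by rewrite enum_valK eqxx.
  by rewrite !mxE enum_rankK enum_valK mulrC.
have M_unit : map_mx evc M \in unitmx.
  move: M0_unit; rewrite !unitmxE !det_map_mx !unitfE; apply: contraNN => /eqP.
  by move/(evc_injective ctr) => ->; rewrite rmorph0.
exists (fun i j => invmx (map_mx evc M) (enum_rank i) (enum_rank j)) => i k.
have /matrixP /(_ (enum_rank i) (enum_rank k)) := mulVmx M_unit.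
rewrite !mxE (inj_eq enum_rank_inj) => <-.
rewrite [RHS](reindex_onto enum_rank enum_val) /= => [|a _]; last exact: enum_valK.
by apply: eq_big => [j|j _]; rewrite ?enum_rankK ?eqxx // !mxE !enum_rankK.
Qed.

(** The ideal generated by c^k in the ring F[c]. *)
Definition cadic k (u : K) : Prop := exists r : {poly F}, u = c ^+ k * evc r.

Lemma cadic0 k : cadic k 0.
Proof. by exists 0; rewrite rmorph0 mulr0. Qed.

Lemma cadicD k u v : cadic k u -> cadic k v -> cadic k (u + v).
Proof. by move=> [r ->] [s ->]; exists (r + s); rewrite rmorphD mulrDr. Qed.

Lemma cadicN k u : cadic k u -> cadic k (- u).
Proof. by move=> [r ->]; exists (- r); rewrite rmorphN mulrN. Qed.

Lemma cadicM k l u v : cadic k u -> cadic l v -> cadic (k + l) (u * v).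
Proof.
by move=> [r ->] [s ->]; exists (r * s); rewrite rmorphM exprD mulrACA.
Qed.

Lemma cadic_nat m : cadic 0 m%:R.
Proof. by exists m%:R; rewrite rmorph_nat mul1r. Qed.

Lemma cadic_c : cadic 1 c.
Proof. by exists 1; rewrite rmorph1 mulr1. Qed.

Lemma cadicW k l u : cadic (k + l) u -> cadic k u.
Proof.
move=> [r ->]; exists ('X ^+ l * r).
by rewrite rmorphM rmorphXn /= evcX exprD mulrA.
Qed.

Lemma cadic_sum k (I : Type) (r : seq I) (A : pred I) (f : I -> K) :
  (forall i, A i -> cadic k (f i)) -> cadic k (\sum_(i <- r | A i) f i).
Proof. by move=> fk; apply: big_ind => //; [apply: cadic0 | apply: cadicD]. Qed.

Section Polynomials.
Variable n : nat.
Local Notation P := {mpoly K[n]}.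
Implicit Types (p q : P).

Definition cpoly k p : Prop := forall m, cadic k p@_m.

Lemma cpoly0 k : cpoly k 0.
Proof. by move=> m; rewrite mcoeff0; apply: cadic0. Qed.

Lemma cpolyD k p q : cpoly k p -> cpoly k q -> cpoly k (p + q).
Proof. by move=> hp hq m; rewrite mcoeffD; apply: cadicD. Qed.

Lemma cpolyN k p : cpoly k p -> cpoly k (- p).
Proof. by move=> hp m; rewrite mcoeffN; apply: cadicN. Qed.

Lemma cpolyB k p q : cpoly k p -> cpoly k q -> cpoly k (p - q).
Proof. by move=> hp hq; apply/cpolyD/cpolyN. Qed.

Lemma cpoly_sum k (I : Type) (r : seq I) (A : pred I) (f : I -> P) :
  (forall i, A i -> cpoly k (f i)) -> cpoly k (\sum_(i <- r | A i) f i).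
Proof. by move=> fk; apply: big_ind => //; [apply: cpoly0 | apply: cpolyD]. Qed.

Lemma cpolyM k l p q : cpoly k p -> cpoly l q -> cpoly (k + l) (p * q).
Proof. by move=> hp hq m; rewrite mcoeffM; apply: cadic_sum => i _; apply: cadicM. Qed.

Lemma cpolyM0 p q : cpoly 0 p -> cpoly 0 q -> cpoly 0 (p * q).
Proof. exact: (@cpolyM 0 0). Qed.

Lemma cpolyZ k l a p : cadic k a -> cpoly l p -> cpoly (k + l) (a *: p).
Proof. by move=> ha hp m; rewrite mcoeffZ; apply: cadicM. Qed.

Lemma cpolyZc k p : cpoly k p -> cpoly k.+1 (c *: p).
Proof. by move=> hp; apply: (@cpolyZ 1) => //; apply: cadic_c. Qed.

Lemma cpolyW k l p : cpoly (k + l) p -> cpoly k p.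
Proof. by move=> hp m; apply: cadicW (hp m). Qed.

Lemma cpolyX m : cpoly 0 'X_[m].
Proof. by move=> m'; rewrite mcoeffX; apply: cadic_nat. Qed.

Lemma cpoly1 : cpoly 0 1.
Proof. by rewrite -mpolyX0; apply: cpolyX. Qed.

Lemma cpoly_prodX (T : {set 'I_n}) : cpoly 0 (\prod_(i in T) 'X_i).
Proof.
apply: big_ind => [||i _]; [exact: cpoly1 | exact: cpolyM0 | exact: cpolyX].
Qed.

Lemma cpoly_exp p e : cpoly 0 p -> cpoly 0 (p ^+ e).
Proof.
move=> hp; elim: e => [|e IHe]; first exact: cpoly1.
by rewrite exprS; apply: cpolyM0.
Qed.

Lemma cpoly_mderiv k i p : cpoly k p -> cpoly k p^`M(i).
Proof.
move=> hp m; rewrite mcoeff_mderiv -mulr_natr -[k]addn0.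
by apply: cadicM; [apply: hp | apply: cadic_nat].
Qed.

Lemma cpoly_msym k w p : cpoly k p -> cpoly k (msym w p).
Proof. by move=> hp m; rewrite mcoeff_sym. Qed.

Lemma cpoly_divdiffX i k m : k != i -> cpoly 0 (divdiff i k ('X_[m] : P)).
Proof.
move=> neq; rewrite mpolyXE_id.
have cM p q : cpoly 0 p -> cpoly 0 (divdiff i k p) -> cpoly 0 q ->
    cpoly 0 (divdiff i k q) -> cpoly 0 (divdiff i k (p * q)).
  move=> hp hdp hq hdq; rewrite (divdiffM _ _ neq).
  by apply: cpolyD; apply: cpolyM0 => //; apply: cpoly_msym.
have cX j : cpoly 0 (divdiff i k 'X_j).
  rewrite (divdiffXi K j neq) -!mpolyC_nat.
  by apply: cpolyB => m'; rewrite mcoeffC -natrM; apply: cadic_nat.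
have c1 : cpoly 0 (divdiff i k 1).
  by rewrite divdiff_sym ?msym1 //; apply: cpoly0.
suff [] : cpoly 0 (\prod_j ('X_j : P) ^+ m j) /\
    cpoly 0 (divdiff i k (\prod_j 'X_j ^+ m j)) by [].
apply: (big_ind (fun p => cpoly 0 p /\ cpoly 0 (divdiff i k p))).
- by split; [apply: cpoly1|].
- move=> p q [hp hdp] [hq hdq]; split; first exact: cpolyM0.
  exact: cM.
move=> j _; split; first exact/cpoly_exp/cpolyX.
elim: (m j) => [|e IHe]; first by rewrite expr0; exact: c1.
rewrite exprS; apply: cM; [exact: cpolyX | exact: cX | | exact: IHe].
exact/cpoly_exp/cpolyX.
Qed.

Lemma cpoly_divdiff l i k p : k != i -> cpoly l p -> cpoly l (divdiff i k p).
Proof.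
move=> neq hp; rewrite [p]mpolyE divdiff_sum //; apply: cpoly_sum => m _.
rewrite divdiffZ //.
by rewrite -[l]addn0; apply: cpolyZ; [apply: hp | apply: cpoly_divdiffX].
Qed.

End Polynomials.
End Specialization.

(** * Singular vectors in characteristic two *)

Section QuarticIdentities.
Variable R : comNzRingType.
Implicit Types p q r x y u w v : R.

(** As a polynomial in x^2 and y^2, the quartic is the relation between two
    variables in the kernel for t = 0; the second polynomial is the first-order
    correction in c that makes it singular for t = 1, where v stands for the sum
    of all cubes. *)
Definition quartic x y := x ^+ 4 + x ^+ 2 * y ^+ 2 + y ^+ 4.
Definition quartic_corr v x y := (x + y) * v + x * y * (x + y) ^+ 2.

(** Modulo 2, the divided differences of both in their first argument. *)
Definition quartic_dd x y u := (x + u) ^+ 3 + (x + u) * y ^+ 2.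
Definition corr_dd v x y u := v + y * (x ^+ 2 + x * u + u ^+ 2) + y ^+ 3.

Hypothesis two0 : 2%:R = 0 :> R.

(** Identities modulo 2 follow from identities over the integers in which the
    difference is an explicit even element. *)
Lemma eq_char2 r p q : p = q + 2%:R * r -> p = q.
Proof. by rewrite two0 mul0r addr0. Qed.

Lemma quartic_ddE x y u :
  (u - x) * quartic_dd x y u = quartic x y - quartic u y.
Proof.
apply: (eq_char2 (r := - x ^+ 3 * u + x * u ^+ 3 + u ^+ 4 + y ^+ 2 * u ^+ 2
  - x ^+ 4 - x ^+ 2 * y ^+ 2)); rewrite /quartic /quartic_dd; ring.
Qed.

Lemma corr_ddE v x y u :
  (u - x) * corr_dd v x y u = quartic_corr v x y - quartic_corr v u y.
Proof.
apply: (eq_char2 (r := v * u + y * u ^+ 3 + y ^+ 3 * u - v * x - x ^+ 3 * y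
  - x * y ^+ 3 - x ^+ 2 * y ^+ 2 + y ^+ 2 * u ^+ 2)).
rewrite /quartic_corr /corr_dd; ring.
Qed.

Lemma quartic_dd_sum x y u :
  quartic_dd x y u + quartic_dd y x u = (x + y) * (x ^+ 2 + y ^+ 2 + u ^+ 2).
Proof.
apply: (eq_char2 (r := 2%:R * x ^+ 2 * u + x * u ^+ 2 + u ^+ 3
  + 2%:R * y ^+ 2 * u + y * u ^+ 2)); rewrite /quartic_dd; ring.
Qed.

Lemma corr_dd_sum v x y u :
  corr_dd v x y u + corr_dd v y x u = (x + y) * (x ^+ 2 + y ^+ 2 + u ^+ 2).
Proof. apply: (eq_char2 (r := v + x * y * u)); rewrite /corr_dd; ring. Qed.

Lemma quartic_dd_expand x y u : quartic_dd x y u =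
  (x ^+ 3 + x * y ^+ 2) + (x ^+ 2 + y ^+ 2) * u + x * u ^+ 2 + 1 * u ^+ 3.
Proof.
apply: (eq_char2 (r := x ^+ 2 * u + x * u ^+ 2)); rewrite /quartic_dd; ring.
Qed.

Lemma corr_dd_expand v x y u : corr_dd v x y u =
  (v + y * x ^+ 2 + y ^+ 3) + x * y * u + y * u ^+ 2 + 0 * u ^+ 3.
Proof. rewrite /corr_dd; ring. Qed.

(** The two left-hand sides are the outcomes of summing the divided differences
    over all variables except the two that occur: the full sum is given by the
    expansions above, and the two excluded terms are added back. *)
Lemma quartic_dd_total x y v :
  (x ^+ 3 + x * y ^+ 2) + 1 * v + quartic_dd x y x + quartic_dd x y y =
  v + x ^+ 2 * y + x * y ^+ 2.
Proof.
apply: (eq_char2 (r := 5%:R * x ^+ 3 + 3%:R * x * y ^+ 2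
  + x ^+ 2 * y + y ^+ 3)); rewrite /quartic_dd; ring.
Qed.

Lemma corr_dd_total x y v :
  (v + y * x ^+ 2 + y ^+ 3) + 0 * v + corr_dd v x y x + corr_dd v x y y =
  v + x ^+ 2 * y + x * y ^+ 2.
Proof.
apply: (eq_char2 (r := v + 2%:R * x ^+ 2 * y + 2%:R * y ^+ 3)).
rewrite /corr_dd; ring.
Qed.

End QuarticIdentities.

Lemma rmorph_quartic (R S : comNzRingType) (f : {rmorphism R -> S}) x y :
  f (quartic x y) = quartic (f x) (f y).
Proof. by rewrite /quartic !rmorphD rmorphM !rmorphXn. Qed.

Lemma rmorph_quartic_corr (R S : comNzRingType) (f : {rmorphism R -> S}) v x y :
  f (quartic_corr v x y) = quartic_corr (f v) (f x) (f y).
Proof. by rewrite /quartic_corr !(rmorphD, rmorphXn, rmorphM). Qed.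

Lemma quarticC (R : comNzRingType) (x y : R) : quartic x y = quartic y x.
Proof. rewrite /quartic; ring. Qed.

Lemma quartic_corrC (R : comNzRingType) (v x y : R) :
  quartic_corr v x y = quartic_corr v y x.
Proof. rewrite /quartic_corr; ring. Qed.

Section Singular.
Variables (K : fieldType) (n : nat).
Hypotheses (charK : 2%N \in [pchar K]) (n_odd : odd n).
Local Notation P := {mpoly K[n]}.
Local Notation s := (sumX K n).
Implicit Types (p q r : P) (i j k a b : 'I_n).

Lemma mpoly_pchar : 2%N \in [pchar P].
Proof. exact: (rmorph_pchar (@mpolyC n K)). Qed.

Lemma mpoly_two0 : 2%:R = 0 :> P.
Proof. exact: pcharf0 mpoly_pchar. Qed.

Lemma mpoly_addpp p : p + p = 0.
Proof. exact: addrr_pchar2 mpoly_pchar _. Qed.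

Lemma mpoly_oppr p : - p = p.
Proof. exact: oppr_pchar2 mpoly_pchar _. Qed.

Lemma mpoly_sqrD p q : (p + q) ^+ 2 = p ^+ 2 + q ^+ 2.
Proof. by apply: (eq_char2 mpoly_two0 (r := p * q)); ring. Qed.

Lemma mpoly_sqr_sum (I : Type) (r : seq I) (A : pred I) (f : I -> P) :
  (\sum_(i <- r | A i) f i) ^+ 2 = \sum_(i <- r | A i) f i ^+ 2.
Proof. by apply: (big_morph (fun p => p ^+ 2) mpoly_sqrD); rewrite expr0n. Qed.

Lemma natr_n : n%:R = 1 :> P.
Proof.
have -> : n%:R = (odd n + n./2.*2)%:R :> P by rewrite odd_double_half.
by rewrite n_odd natrD -mul2n natrM mpoly_two0 mul0r addr0.
Qed.

(** A sum of n ones is 1, so that the x_i + s sum to zero in the polynomial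
    ring itself, and not only modulo s; since the Dunkl operators involve
    only differences of variables, they act on polynomials in the x_i + s as
    they do in the quotient by s. *)
Definition Xs i : P := 'X_i + s.

Lemma sum_Xs : \sum_i Xs i = 0.
Proof.
rewrite /Xs big_split /= sumr_const card_ord -mulr_natl natr_n mul1r.
exact: mpoly_addpp.
Qed.

Lemma sum_Xs2 : \sum_i Xs i ^+ 2 = 0.
Proof. by rewrite -mpoly_sqr_sum sum_Xs expr0n. Qed.

Definition cubes : P := \sum_i Xs i ^+ 3.

Lemma sum_cubic (u v w y : P) :
  \sum_i (u + v * Xs i + w * Xs i ^+ 2 + y * Xs i ^+ 3) = u + y * cubes.
Proof.
rewrite !big_split -!mulr_sumr sum_Xs sum_Xs2 /=.
rewrite !mulr0 !addr0 sumr_const.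
by rewrite card_ord -mulr_natl natr_n mul1r.
Qed.

Lemma msym_Xs w i : msym w (Xs i) = Xs (w i).
Proof. by rewrite /Xs msymD msymXi msym_sumX. Qed.

Lemma msym_cubes w : msym w cubes = cubes.
Proof.
rewrite /cubes [msym w _](raddf_sum (msym w)) [RHS](reindex_inj (@perm_inj _ w)).
by apply: eq_bigr => i _; rewrite [LHS](rmorphXn (msym w)) /= msym_Xs.
Qed.

Lemma divdiff_Xs i k p q : k != i ->
  (Xs i - Xs k) * q = p - msym (tperm i k) p -> divdiff i k p = q.
Proof.
move=> neq e; apply: divdiff_eq => //; rewrite -e /Xs; congr (_ * _).
by rewrite opprD addrACA subrr addr0.
Qed.

Lemma mderiv_sumX i : s^`M(i) = 1.
Proof.
rewrite /sumX (raddf_sum (mderiv i)) (bigD1 i) //= mderivXi eqxx big1 ?addr0 //.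
by move=> j neq; rewrite mderivXi (negPf neq).
Qed.

Lemma mderiv_Xs i j : (Xs j)^`M(i) = (j != i)%:R.
Proof.
rewrite /Xs mderivD mderivXi mderiv_sumX.
by case: eqP => _; rewrite ?add0r //; apply: mpoly_addpp.
Qed.

Lemma mderiv_sqr i p : (p ^+ 2)^`M(i) = 0.
Proof. by rewrite expr2 mderivM [p * _]mulrC mpoly_addpp. Qed.

Definition reflsum i p : P := \sum_(k | k != i) divdiff i k p.

Lemma dunkl_char2 c i p : dunkl 1 c i p = p^`M(i) + c *: reflsum i p.
Proof. by rewrite /dunkl scale1r mpoly_oppr. Qed.

Section ReflectionSum.
Variables (q : 'I_n -> 'I_n -> P) (dd : P -> P -> P -> P) (a b : 'I_n).
Hypotheses (q_sym : forall w i j, msym w (q i j) = q (w i) (w j))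
  (qC : forall i j, q i j = q j i)
  (ddE : forall i j k, (Xs k - Xs i) * dd (Xs i) (Xs j) (Xs k) = q i j - q k j)
  (neq_ab : a != b).

Lemma reflsum_other i : i != a -> i != b ->
  reflsum i (q a b) = dd (Xs a) (Xs b) (Xs i) + dd (Xs b) (Xs a) (Xs i).
Proof.
move=> ia ib; have [ai bi ba] : [/\ a != i, b != i & b != a].
  by split; rewrite eq_sym.
rewrite /reflsum (bigD1 a) //= (bigD1 b) /=; last by rewrite bi.
rewrite [X in _ + (_ + X)]big1; last first.
  move=> k /andP[/andP[ki ka] kb].
  by apply: divdiff_sym; rewrite // q_sym !tpermD // eq_sym.
rewrite [X in _ + X]addr0.
rewrite (@divdiff_Xs i a _ (dd (Xs a) (Xs b) (Xs i))) //; last first.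
  by rewrite ddE q_sym tpermR tpermD.
rewrite (@divdiff_Xs i b _ (dd (Xs b) (Xs a) (Xs i))) //.
by rewrite ddE q_sym tpermR tpermD // (qC a i) (qC a b).
Qed.

Lemma reflsum_first u v w y :
    (forall k, dd (Xs a) (Xs b) (Xs k) =
       u + v * Xs k + w * Xs k ^+ 2 + y * Xs k ^+ 3) ->
  reflsum a (q a b) = u + y * cubes
    + dd (Xs a) (Xs b) (Xs a) + dd (Xs a) (Xs b) (Xs b).
Proof.
move=> expand; have ba : b != a by rewrite eq_sym.
rewrite -(sum_cubic u v w y) -(eq_bigr _ (fun k _ => expand k)).
rewrite [in RHS](bigD1 a) //= [in RHS](bigD1 b) //=.
set S := \sum_(_ | _) _; set ya := dd _ _ (Xs a); set yb := dd _ _ (Xs b).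
have -> : ya + (yb + S) + ya + yb = S.
  by apply: (eq_char2 mpoly_two0 (r := ya + yb)); ring.
rewrite /reflsum (bigD1 b) //= divdiff_sym //; last first.
  by rewrite q_sym tpermL tpermR qC.
rewrite add0r; apply: eq_bigr => k /andP[ka kb].
apply: divdiff_Xs => //; rewrite -[RHS]mpoly_oppr q_sym tpermL tpermD // 1?eq_sym //.
by rewrite -ddE -mulNr opprB.
Qed.

End ReflectionSum.

(** The common value of the reflection sums of the quartic and of its
    correction, and of the derivative of the correction. *)
Definition corr_deriv a b i : P :=
  let x := Xs a in let y := Xs b in
  if (i == a) || (i == b) then cubes + x ^+ 2 * y + x * y ^+ 2
  else (x + y) * (x ^+ 2 + y ^+ 2 + Xs i ^+ 2).

Local Notation q0 a b := (quartic (Xs a) (Xs b)).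
Local Notation q1 a b := (quartic_corr cubes (Xs a) (Xs b)).

Lemma msym_q0 w a b : msym w (q0 a b) = q0 (w a) (w b).
Proof. by rewrite (rmorph_quartic (msym w)) /= !msym_Xs. Qed.

Lemma msym_q1 w a b : msym w (q1 a b) = q1 (w a) (w b).
Proof. by rewrite (rmorph_quartic_corr (msym w)) /= !msym_Xs msym_cubes. Qed.

Lemma corr_derivC a b i : corr_deriv a b i = corr_deriv b a i.
Proof. by rewrite /corr_deriv orbC; case: ifP => _; ring. Qed.

Lemma reflsum_q0 a b i : a != b -> reflsum i (q0 a b) = corr_deriv a b i.
Proof.
have dd j l k := quartic_ddE mpoly_two0 (Xs j) (Xs l) (Xs k).
have qC j l := quarticC (Xs j) (Xs l).
have first j l : j != l -> reflsum j (q0 j l) = corr_deriv j l j.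
  move=> ne; rewrite (reflsum_first msym_q0 qC dd ne
    (fun k => quartic_dd_expand mpoly_two0 (Xs j) (Xs l) (Xs k))).
  by rewrite quartic_dd_total ?mpoly_two0 // /corr_deriv eqxx.
move=> neq; have [->|ia] := eqVneq i a; first exact: first.
have [->|ib] := eqVneq i b.
  by rewrite qC corr_derivC; apply: first; rewrite eq_sym.
rewrite (reflsum_other msym_q0 qC dd neq ia ib) quartic_dd_sum ?mpoly_two0 //.
by rewrite /corr_deriv (negPf ia) (negPf ib).
Qed.

Lemma reflsum_q1 a b i : a != b -> reflsum i (q1 a b) = corr_deriv a b i.
Proof.
have dd j l k := corr_ddE mpoly_two0 cubes (Xs j) (Xs l) (Xs k).
have qC j l := quartic_corrC cubes (Xs j) (Xs l).
have first j l : j != l -> reflsum j (q1 j l) = corr_deriv j l j.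
  move=> ne; rewrite (reflsum_first msym_q1 qC dd ne
    (fun k => corr_dd_expand cubes (Xs j) (Xs l) (Xs k))).
  by rewrite corr_dd_total ?mpoly_two0 // /corr_deriv eqxx.
move=> neq; have [->|ia] := eqVneq i a; first exact: first.
have [->|ib] := eqVneq i b.
  by rewrite qC corr_derivC; apply: first; rewrite eq_sym.
rewrite (reflsum_other msym_q1 qC dd neq ia ib) corr_dd_sum ?mpoly_two0 //.
by rewrite /corr_deriv (negPf ia) (negPf ib).
Qed.

Lemma mderiv_cubes i : cubes^`M(i) = Xs i ^+ 2.
Proof.
have d3 k : (Xs k ^+ 3)^`M(i) = (k != i)%:R * Xs k ^+ 2.
  by rewrite exprS mderivM mderiv_sqr mulr0 addr0 mderiv_Xs.
rewrite /cubes (raddf_sum (mderiv i)) (eq_bigr _ (fun k _ => d3 k)) /=.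
rewrite (bigD1 i) //= eqxx mul0r add0r.
rewrite (eq_bigr (fun k => Xs k ^+ 2)) => [|k ->]; last by rewrite mul1r.
have := sum_Xs2; rewrite (bigD1 i) //= => /eqP.
by rewrite addrC addr_eq0 mpoly_oppr => /eqP.
Qed.

Lemma mderiv_q0 a b i : (q0 a b)^`M(i) = 0.
Proof.
have sq (x y : P) : quartic x y = (x ^+ 2 + x * y + y ^+ 2) ^+ 2.
  apply: (eq_char2 mpoly_two0
    (r := - x ^+ 2 * y ^+ 2 - x * y * (x ^+ 2 + y ^+ 2))).
  by rewrite /quartic; ring.
by rewrite sq mderiv_sqr.
Qed.

Lemma mderiv_q1 a b i : a != b -> (q1 a b)^`M(i) = corr_deriv a b i.
Proof.
have d j l : (q1 j l)^`M(i) = ((j != i)%:R + (l != i)%:R) * cubes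
    + (Xs j + Xs l) * Xs i ^+ 2
    + ((j != i)%:R * Xs l + Xs j * (l != i)%:R) * (Xs j + Xs l) ^+ 2.
  rewrite /quartic_corr mderivD (mderivM _ (_ + _)) (mderivM _ (_ * _)).
  rewrite (mderivM _ (Xs j)) mderiv_sqr mulr0 addr0.
  by rewrite mderivD !mderiv_Xs mderiv_cubes.
have first j l : i = j -> j != l -> (q1 j l)^`M(i) = corr_deriv j l i.
  move=> ij ne; rewrite d /corr_deriv ij eqxx eq_sym ne /=.
  move: (Xs j) (Xs l) cubes => x y v.
  by apply: (eq_char2 mpoly_two0 (r := x ^+ 3 + x ^+ 2 * y)); ring.
move=> neq; have [ia|ia] := eqVneq i a; first exact: first.
have [ib|ib] := eqVneq i b.
  by rewrite quartic_corrC corr_derivC; apply: first; rewrite // eq_sym.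
rewrite d /corr_deriv (negPf ia) (negPf ib) ![_ == i]eq_sym ia ib /=.
move: (Xs a) (Xs b) (Xs i) cubes => x y u v.
by apply: (eq_char2 mpoly_two0 (r := v + x ^+ 2 * y + x * y ^+ 2)); ring.
Qed.

(** Since the quartic q0 is a square, its Dunkl image is c r, where r is the
    reflection sum; the correction q1 has Dunkl image r + c r. Hence
    q0 + c / (1 + c) q1 is killed in characteristic two; the vector below is
    this one multiplied by 1 + c. *)
Definition singular_quartic c a b : P := (1 + c) *: q0 a b + c *: q1 a b.

Lemma reflsumD i p q : reflsum i (p + q) = reflsum i p + reflsum i q.
Proof.
rewrite /reflsum -big_split; apply: eq_bigr => k neq.
apply: divdiff_eq => //.
by rewrite mulrDr [X in X + _]divdiffE divdiffE msymD opprD addrACA.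
Qed.

Lemma reflsumZ i (u : K) p : reflsum i (u *: p) = u *: reflsum i p.
Proof.
by rewrite /reflsum scaler_sumr; apply: eq_bigr => k neq; apply: divdiffZ.
Qed.

Lemma dunkl_singular_quartic c a b i : a != b ->
  dunkl 1 c i (singular_quartic c a b) = 0.
Proof.
move=> neq; rewrite dunkl_char2 /singular_quartic mderivD !mderivZ.
rewrite reflsumD !reflsumZ mderiv_q0 mderiv_q1 // reflsum_q0 // reflsum_q1 //.
rewrite scaler0 add0r -scalerDl scalerA -scalerDl.
have -> : c + c * (1 + c + c) = 2%:R * (c + c ^+ 2) by ring.
by rewrite (pcharf0 charK) mul0r scale0r.
Qed.

End Singular.

(** * An ideal inside the kernel *)

Section KernelIdeal.
Variables (K : fieldType) (n : nat) (c : K).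
Hypotheses (charK : 2%N \in [pchar K]) (n_odd : odd n).
Local Notation P := {mpoly K[n]}.
Local Notation s := (sumX K n).
Local Notation h := (hspace K n).
Implicit Types (p q r g : P) (i j k a b : 'I_n).

(** The square of any symmetric polynomial is singular for t = 1, since its
    derivatives and its divided differences vanish. This one is needed to kill
    the cube of each x_i^2. *)
Definition sum_cubes : P := \sum_i 'X_i ^+ 3.

Inductive kernel_gen : P -> Prop :=
| kernel_gen_sum : kernel_gen s
| kernel_gen_quartic a b : a != b -> kernel_gen (singular_quartic c a b)
| kernel_gen_cubes : kernel_gen (sum_cubes ^+ 2).

Inductive kernel_ideal : P -> Prop :=
| kernel_ideal0 : kernel_ideal 0
| kernel_ideal_cons (u : K) m g p : kernel_gen g -> kernel_ideal p ->
    kernel_ideal (u *: ('X_[m] * g) + p).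

Lemma kernel_idealD p q : kernel_ideal p -> kernel_ideal q -> kernel_ideal (p + q).
Proof.
move=> + Jq; elim=> [|u m g r gg _ IHr]; first by rewrite add0r.
by rewrite -addrA; apply: kernel_ideal_cons.
Qed.

Lemma kernel_idealZ (u : K) p : kernel_ideal p -> kernel_ideal (u *: p).
Proof.
elim=> [|v m g r gg _ IHr]; first by rewrite scaler0; apply: kernel_ideal0.
by rewrite scalerDr scalerA; apply: kernel_ideal_cons.
Qed.

Lemma kernel_idealM r p : kernel_ideal p -> kernel_ideal (r * p).
Proof.
move=> Jp; elim/mpolyind: r => [|u m r _ _ Jr].
  by rewrite mul0r; apply: kernel_ideal0.
rewrite mulrDl -scalerAl; apply: kernel_idealD Jr; apply: kernel_idealZ.
elim: Jp => [|v m' g q gg _ IHq]; first by rewrite mulr0; apply: kernel_ideal0.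
rewrite mulrDr -[X in X + _]scalerAr mulrA -mpolyXD.
exact: kernel_ideal_cons.
Qed.

Lemma kernel_ideal_gen g : kernel_gen g -> kernel_ideal g.
Proof.
move=> gg; have := kernel_ideal_cons 1 0%MM gg kernel_ideal0.
by rewrite mpolyX0 mul1r scale1r addr0.
Qed.

Lemma kernel_ideal_sum (I : Type) (r : seq I) (A : pred I) (f : I -> P) :
  (forall x, A x -> kernel_ideal (f x)) -> kernel_ideal (\sum_(x <- r | A x) f x).
Proof.
by move=> Jf; apply: big_ind => //; [apply: kernel_ideal0 | apply: kernel_idealD].
Qed.

Lemma msym_sum_cubes_sqr w : msym w (sum_cubes ^+ 2) = sum_cubes ^+ 2.
Proof.
rewrite [LHS](rmorphXn (msym w)) /=; congr (_ ^+ 2).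
rewrite /sum_cubes [LHS](raddf_sum (msym w)) [RHS](reindex_inj (@perm_inj _ w)).
by apply: eq_bigr => i _; rewrite [LHS](rmorphXn (msym w)) /= msymXi.
Qed.

Lemma msym_kernel_gen w g : kernel_gen g -> kernel_gen (msym w g).
Proof.
case=> [|a b neq|]; first by rewrite msym_sumX; apply: kernel_gen_sum.
  rewrite /singular_quartic msymD !msymZ msym_q0 msym_q1 .
  by apply: kernel_gen_quartic; rewrite (inj_eq perm_inj).
by rewrite msym_sum_cubes_sqr; apply: kernel_gen_cubes.
Qed.

Lemma reflsum_sym i p : (forall w, msym w p = p) -> reflsum i p = 0.
Proof. by move=> symp; apply: big1 => k neq; apply: divdiff_sym. Qed.

Lemma dunklv_kernel_gen v g : v \in h -> kernel_gen g -> dunklv 1 c v g = 0.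
Proof.
move=> /hspace_sum0 v0; case=> [|a b neq|].
- transitivity (\sum_i v 0 i *: (1 : P)); last by rewrite -scaler_suml v0 scale0r.
  apply: eq_bigr => i _; rewrite dunkl_char2 // mderiv_sumX reflsum_sym.
    by rewrite scaler0 addr0.
  exact: msym_sumX.
- by apply: big1 => i _; rewrite dunkl_singular_quartic ?scaler0.
apply: big1 => i _; rewrite dunkl_char2 // mderiv_sqr // reflsum_sym.
  by rewrite scaler0 addr0 scaler0.
exact: msym_sum_cubes_sqr.
Qed.

Lemma dunklM i r g : dunkl 1 c i (r * g) = r * dunkl 1 c i g + (r^`M(i) * g +
  c *: \sum_(k | k != i) divdiff i k r * msym (tperm i k) g).
Proof.
rewrite !(dunkl_char2 charK) mderivM.
have -> : reflsum i (r * g) = r * reflsum i g +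
    \sum_(k | k != i) divdiff i k r * msym (tperm i k) g.
  rewrite /reflsum mulr_sumr -big_split; apply: eq_bigr => k neq.
  exact: divdiffM.
move: (\sum_(_ | _) _) (reflsum i g) (r^`M(i)) (g^`M(i)) => S x y z.
by rewrite -!mul_mpolyC; ring.
Qed.

(** By the twisted Leibniz rule, an ideal generated by an Sn-stable set of
    singular vectors is stable under the Dunkl operators. *)
Lemma kernel_ideal_dunklv v p :
  v \in h -> kernel_ideal p -> kernel_ideal (dunklv 1 c v p).
Proof.
move=> hv; elim=> [|u m g q gg _ IHq].
  by rewrite linear0; apply: kernel_ideal0.
rewrite dunklv_is_linear; apply: kernel_idealD IHq; apply: kernel_idealZ.
pose X i := ('X_[m])^`M(i) * g +
  c *: \sum_(k | k != i) divdiff i k 'X_[m] * msym (tperm i k) g.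
have -> : dunklv 1 c v ('X_[m] * g) =
    'X_[m] * dunklv 1 c v g + \sum_i v 0 i *: X i.
  rewrite /dunklv mulr_sumr -big_split; apply: eq_bigr => i _.
  by rewrite dunklM scalerDr scalerAr.
rewrite dunklv_kernel_gen // mulr0 add0r; apply: kernel_ideal_sum => i _.
apply: kernel_idealZ; rewrite /X; apply: kernel_idealD.
  exact/kernel_idealM/kernel_ideal_gen.
apply: kernel_idealZ; apply: kernel_ideal_sum => k neq.
exact/kernel_idealM/kernel_ideal_gen/msym_kernel_gen.
Qed.

Lemma Xs_homog i : Xs K i \is 1.-homog.
Proof.
apply: rpredD; first by rewrite dhomogX /= mdeg1.
by apply: rpred_sum => j _; rewrite dhomogX /= mdeg1.
Qed.

Lemma kernel_gen_homog g : kernel_gen g -> exists e, g \is e.+1.-homog.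
Proof.
have X1 i : ('X_i : P) \is 1.-homog by rewrite dhomogX /= mdeg1.
have sX2 i := dhomogMn 2 (Xs_homog i); have sX4 i := dhomogMn 4 (Xs_homog i).
have cubes3 : cubes K n \is 3.-homog.
  by apply: rpred_sum => i _; exact: (dhomogMn 3 (Xs_homog i)).
case=> [|a b neq|].
- by exists 0; apply: rpred_sum => i _.
- exists 3; rewrite /singular_quartic; apply: rpredD; apply: rpredZ.
    rewrite /quartic; apply: rpredD; last exact: sX4.
    by apply: rpredD; [exact: sX4 | exact: (dhomogM (sX2 a) (sX2 b))].
  have ab1 : Xs K a + Xs K b \is 1.-homog by rewrite rpredD ?Xs_homog.
  rewrite /quartic_corr; apply: rpredD; first exact: (dhomogM ab1 cubes3).
  apply: (dhomogM (dhomogM (Xs_homog a) (Xs_homog b))).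
  exact: (dhomogMn 2 ab1).
exists 5; apply: (@dhomogMn _ _ _ 3 _ 2).
by apply: rpred_sum => i _; exact: (dhomogMn 3 (X1 i)).
Qed.

Lemma kernel_ideal_coeff0 p : kernel_ideal p -> p@_0%MM = 0.
Proof.
elim=> [|u m g q gg _ IHq]; first by rewrite mcoeff0.
have [e ge] := kernel_gen_homog gg.
rewrite mcoeffD mcoeffZ IHq addr0 (mcoeff0_is_multiplicative n K).1.
by rewrite (dhomog_nemf_coeff ge) ?mulr0 //= mdeg0.
Qed.

Lemma kernel_ideal_pihomog d p :
  kernel_ideal p -> kernel_ideal (pihomog mdeg d p).
Proof.
elim=> [|u m g q gg _ IHq]; first by rewrite pihomog0; apply: kernel_ideal0.
rewrite linearP /=; apply: kernel_idealD IHq; apply: kernel_idealZ.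
have [e ge] := kernel_gen_homog gg.
have mge : ('X_[m] * g) \is (mdeg m + e.+1).-homog.
  by apply: dhomogM => //; rewrite dhomogX /=.
have [eqd|ned] := eqVneq (mdeg m + e.+1)%N d.
  rewrite -eqd (pihomog_dE mge); exact/kernel_idealM/kernel_ideal_gen.
by rewrite (pihomog_ne0 ned mge); apply: kernel_ideal0.
Qed.

Lemma kernel_ideal_ker p : kernel_ideal p -> piA p \in ker_cform 1 c.
Proof.
apply: ker_of_stable.
- exact: kernel_idealD.
- exact: kernel_idealZ.
- by move=> v q; apply: kernel_ideal_dunklv.
exact: kernel_ideal_coeff0.
Qed.

End KernelIdeal.

(** * The basis monomials span the quotient *)

Section Spanning.
Variables (F K : fieldType) (iota : {rmorphism F -> K}) (n : nat) (c : K).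
Hypotheses (charK : 2%N \in [pchar K]) (n_odd : odd n).
Local Notation P := {mpoly K[n]}.
Local Notation s := (sumX K n).
Local Notation cpoly := (@cpoly F K iota c n).
Implicit Types (p q r : P) (i j k a b : 'I_n).

(** Modulo c the relations in the kernel lose their corrections and become
    polynomial identities between the squares of the variables. *)
Definition near_ideal p : Prop :=
  exists j v : P, [/\ kernel_ideal c j, cpoly 1 v & p = j + v].

Lemma near_ideal_of p : kernel_ideal c p -> near_ideal p.
Proof. by move=> Jp; exists p, 0; split=> //; [apply: cpoly0 | rewrite addr0]. Qed.

Lemma near_idealD p q : near_ideal p -> near_ideal q -> near_ideal (p + q).
Proof.
move=> [j [v [Jj Vv ->]]] [j' [v' [Jj' Vv' ->]]]; exists (j + j'), (v + v').
by split; [apply: kernel_idealD | apply: cpolyD | rewrite addrACA].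
Qed.

Lemma near_idealM r p : cpoly 0 r -> near_ideal p -> near_ideal (r * p).
Proof.
move=> Vr [j [v [Jj Vv ->]]]; exists (r * j), (r * v).
by split; [apply: kernel_idealM | apply: (@cpolyM _ _ _ _ _ 0 1) | rewrite mulrDr].
Qed.

Lemma near_ideal_sum (I : Type) (r : seq I) (A : pred I) (f : I -> P) :
  (forall x, A x -> near_ideal (f x)) -> near_ideal (\sum_(x <- r | A x) f x).
Proof.
move=> Jf; apply: big_ind => //; last exact: near_idealD.
exact/near_ideal_of/kernel_ideal0.
Qed.

Let two0 := mpoly_two0 n charK.

Lemma near_ideal_trans q p r :
  near_ideal (p + q) -> near_ideal (q + r) -> near_ideal (p + r).
Proof.
move=> pq qr; have -> : p + r = (p + q) + (q + r); last exact: near_idealD.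
by apply: (eq_char2 two0 (r := - q)); ring.
Qed.

Lemma near_ideal_refl p : near_ideal (p + p).
Proof. by rewrite mpoly_addpp //; exact/near_ideal_of/kernel_ideal0. Qed.

Lemma near_ideal_s : near_ideal s.
Proof. exact/near_ideal_of/kernel_ideal_gen/kernel_gen_sum. Qed.

Lemma cpoly_Xi i : cpoly 0 'X_i. Proof. exact: cpolyX. Qed.

Lemma cpoly_s : cpoly 0 s.
Proof. by apply: cpoly_sum => i _; apply: cpoly_Xi. Qed.

Lemma cpoly_Xs i : cpoly 0 (Xs K i).
Proof. by apply: cpolyD; [apply: cpoly_Xi | apply: cpoly_s]. Qed.

Local Notation label := ({set 'I_n} * (bool * 'I_n))%type.
Local Notation A i := ('X_i ^+ 2 : P).

Lemma cpoly_A i : cpoly 0 (A i). Proof. exact/cpoly_exp/cpoly_Xi. Qed.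

(** The leading part at c = 0 of the singular quartic. *)
Lemma near_ideal_quadric a b : a != b ->
  near_ideal (A a ^+ 2 + A a * A b + A b ^+ 2).
Proof.
move=> neq; pose q0 := quartic (Xs K a) (Xs K b).
pose q1 := quartic_corr (cubes K n) (Xs K a) (Xs K b).
have Vq0 : cpoly 0 q0.
  have X i e : cpoly 0 (Xs K i ^+ e) by apply/cpoly_exp/cpoly_Xs.
  by apply: cpolyD => //; apply: cpolyD => //; apply: cpolyM0.
have Vq1 : cpoly 0 q1.
  have Vab : cpoly 0 (Xs K a + Xs K b) by apply: cpolyD; apply: cpoly_Xs.
  apply: cpolyD; apply: cpolyM0 => //.
  - by apply: cpoly_sum => i _; apply/cpoly_exp/cpoly_Xs.
  - by apply: cpolyM0; apply: cpoly_Xs.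
  - exact: cpoly_exp.
(* The quartic differs from the singular vector by a multiple of c. *)
have Jq0 : near_ideal q0.
  exists (singular_quartic c a b), (c *: (q0 + q1)); split.
  - exact/kernel_ideal_gen/kernel_gen_quartic.
  - exact/cpolyZc/cpolyD.
  apply: (eq_char2 two0 (r := - (c *: (q0 + q1)))).
  rewrite /singular_quartic -/q0 -/q1; move: q0 q1 {Vq0 Vq1} => u v.
  rewrite scalerDl scale1r scalerDr; move: (c *: u) (c *: v) => cu cv; ring.
have -> : A a ^+ 2 + A a * A b + A b ^+ 2 = q0 + (s * (A a + A b) + s ^+ 3) * s.
  rewrite /q0 /Xs /quartic; move: 'X_a 'X_b s => x y w.
  by apply: (eq_char2 two0 (r := - 2%:R * w * x ^+ 3
    - 4%:R * w ^+ 2 * x ^+ 2 - 3%:R * w ^+ 3 * x - 2%:R * w ^+ 4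
    - w * x ^+ 2 * y - w * x * y ^+ 2 - 2%:R * w ^+ 2 * x * y
    - 4%:R * w ^+ 2 * y ^+ 2 - 3%:R * w ^+ 3 * y - 2%:R * w * y ^+ 3)); ring.
apply: near_idealD => //; apply: near_idealM near_ideal_s.
apply: cpolyD; last exact/cpoly_exp/cpoly_s.
by apply: cpolyM0; [apply: cpoly_s | apply: cpolyD; apply: cpoly_A].
Qed.

(** The cubes are all congruent, by the factorization of their differences, and
    an odd number of them sums to zero. *)
Lemma near_ideal_cube a : near_ideal (A a ^+ 3).
Proof.
have ab b : near_ideal (A a ^+ 3 + A b ^+ 3).
  have [<-|neq] := eqVneq a b; first exact: near_ideal_refl.
  have -> : A a ^+ 3 + A b ^+ 3 = (A a + A b) * (A a ^+ 2 + A a * A b + A b ^+ 2).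
    by apply: (eq_char2 two0 (r := - A a ^+ 2 * A b - A a * A b ^+ 2)); ring.
  by apply: near_idealM (near_ideal_quadric neq); apply: cpolyD; apply: cpoly_A.
have -> : A a ^+ 3 = \sum_b (A a ^+ 3 + A b ^+ 3) + \sum_b A b ^+ 3.
  rewrite big_split /= sumr_const card_ord -mulr_natl natr_n // mul1r.
  by rewrite -addrA mpoly_addpp // addr0.
apply: near_idealD; first by apply: near_ideal_sum => b _; apply: ab.
have -> : \sum_b A b ^+ 3 = sum_cubes K n ^+ 2.
  rewrite mpoly_sqr_sum //; apply: eq_bigr => b _.
  by rewrite -!exprM mulnC.
exact/near_ideal_of/kernel_ideal_gen/kernel_gen_cubes.
Qed.

Lemma near_ideal_swap a b : a != b ->
  near_ideal (A a ^+ 2 * A b + A b ^+ 2 * A a).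
Proof.
move=> neq.
have -> : A a ^+ 2 * A b + A b ^+ 2 * A a =
    A a * (A a ^+ 2 + A a * A b + A b ^+ 2) + A a ^+ 3.
  by apply: (eq_char2 two0 (r := - A a ^+ 3)); ring.
apply: near_idealD (near_ideal_cube a).
exact: near_idealM (cpoly_A _) (near_ideal_quadric neq).
Qed.

(** The product of three distinct squares can be reduced in two ways, and the
    comparison of the results gives this relation. *)
Lemma near_ideal_right a b d : a != d -> b != d ->
  near_ideal (A d ^+ 2 * A a + A d ^+ 2 * A b).
Proof.
move=> ad bd; have [<-|ab] := eqVneq a b; first exact: near_ideal_refl.
have -> : A d ^+ 2 * A a + A d ^+ 2 * A b =
    A a * (A b ^+ 2 + A b * A d + A d ^+ 2) +
    A b * (A a ^+ 2 + A a * A d + A d ^+ 2) + (A a ^+ 2 * A b + A b ^+ 2 * A a).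
  by apply: (eq_char2 two0
    (r := - A a * A b ^+ 2 - A a * A b * A d - A a ^+ 2 * A b)); ring.
apply: near_idealD (near_ideal_swap ab); apply: near_idealD.
  exact: near_idealM (cpoly_A _) (near_ideal_quadric bd).
exact: near_idealM (cpoly_A _) (near_ideal_quadric ad).
Qed.

(** The products A_a^2 A_b span a single line, the socle of the core. *)
Lemma near_ideal_socle a b d e : a != b -> d != e ->
  near_ideal (A a ^+ 2 * A b + A d ^+ 2 * A e).
Proof.
move=> ab de; have [ad|ad] := eqVneq a d.
  by rewrite ad; apply: near_ideal_right; rewrite eq_sym // -ad.
apply: (near_ideal_trans (q := A a ^+ 2 * A d)).
  by apply: near_ideal_right; rewrite eq_sym.
apply: (near_ideal_trans (q := A d ^+ 2 * A a)); first exact: near_ideal_swap.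
by apply: near_ideal_right; rewrite // eq_sym.
Qed.

Variables (z i1 i2 : 'I_n).
Hypotheses (z1 : i1 != z) (z2 : i2 != z) (i12 : i1 != i2).

(** A basis of the analogous quotient for t = 0, whose Hilbert series is
    1 + (n-1) X + (n-1) X^2 + X^3; the index z stands for the two extreme
    degrees and the other indices for the two middle ones. *)
Definition core_mono (u : bool * 'I_n) : P :=
  if u.2 == z then if u.1 then 'X_i1 ^+ 2 * 'X_i2 else 1
  else if u.1 then 'X_(u.2) ^+ 2 else 'X_(u.2).

Definition core_deg (u : bool * 'I_n) : nat :=
  if u.2 == z then if u.1 then 3 else 0 else if u.1 then 2 else 1.

(** A square-free part in the variables other than x_z, times a core monomial in
    the squares of the variables; in characteristic two the latter is the square
    of the core monomial. *)
Definition basis_mono (l : {set 'I_n} * (bool * 'I_n)) : P :=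
  (\prod_(a in l.1) 'X_a) * core_mono l.2 ^+ 2.

(** Only sums are needed here, without scalars: every reduction rule has
    coefficients 0 and 1. *)
Inductive sqspan : P -> Prop :=
| sqspan_core u : sqspan (core_mono u ^+ 2)
| sqspan_near p : near_ideal p -> sqspan p
| sqspanD p q : sqspan p -> sqspan q -> sqspan (p + q).

Lemma sqspan_sum (I : Type) (r : seq I) (B : pred I) (f : I -> P) :
  (forall x, B x -> sqspan (f x)) -> sqspan (\sum_(x <- r | B x) f x).
Proof.
move=> Jf; apply: big_ind => //; last exact: sqspanD.
exact/sqspan_near/near_ideal_of/kernel_ideal0.
Qed.

Lemma sqspan_eq q p : near_ideal (p + q) -> sqspan q -> sqspan p.
Proof.
move=> pq Sq; have -> : p = (p + q) + q.
  by rewrite -addrA mpoly_addpp // addr0.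
by apply: sqspanD Sq; apply: sqspan_near.
Qed.

Lemma sqspan_one : sqspan 1.
Proof. by have := sqspan_core (false, z); rewrite /core_mono eqxx expr1n. Qed.

Lemma sqspan_A k : sqspan (A k).
Proof.
have other j : j != z -> sqspan (A j).
  by move=> jz; have := sqspan_core (false, j); rewrite /core_mono /= (negPf jz).
have [->|] := eqVneq k z; last exact: other.
apply: (sqspan_eq (q := \sum_(j | j != z) A j)); last exact: sqspan_sum.
have <- : \sum_j A j = A z + \sum_(j | j != z) A j by rewrite (bigD1 z).
rewrite -mpoly_sqr_sum //.
by rewrite expr2; apply: near_idealM cpoly_s near_ideal_s.
Qed.

Lemma sqspan_A2 k : sqspan (A k ^+ 2).
Proof.
have other j : j != z -> sqspan (A j ^+ 2).
  by move=> jz; have := sqspan_core (true, j); rewrite /core_mono /= (negPf jz).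
have [->|] := eqVneq k z; last exact: other.
apply: (sqspan_eq (q := \sum_(j | j != z) A j ^+ 2)); last exact: sqspan_sum.
have <- : \sum_j A j ^+ 2 = A z ^+ 2 + \sum_(j | j != z) A j ^+ 2.
  by rewrite (bigD1 z).
rewrite -!mpoly_sqr_sum //.
rewrite -exprM exprSr; apply: near_idealM near_ideal_s.
exact/cpoly_exp/cpoly_s.
Qed.

Lemma sqspan_socle a b : a != b -> sqspan (A a ^+ 2 * A b).
Proof.
move=> ab; apply: (sqspan_eq (near_ideal_socle ab i12)).
have := sqspan_core (true, z); rewrite /core_mono eqxx /=.
by rewrite exprMn.
Qed.

(** Degree by degree: 1, A_a, A_a^2, the socle, zero. *)
Lemma sqspanM i p : sqspan p -> sqspan (A i * p).
Proof.
elim=> [u|q Jq|q r _ IHq _ IHr]; last by rewrite mulrDr; apply: sqspanD.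
  2: exact/sqspan_near/near_idealM/Jq/cpoly_A.
case: u => u a; rewrite /core_mono /=; have [_|az] := eqVneq a z; case: u.
- rewrite exprMn.
  have [b ib] : exists b, i != b.
    by have [->|] := eqVneq i i1; [exists i2 | exists i1].
  apply: (sqspan_eq (q := A i * (A i ^+ 2 * A b))).
    rewrite -mulrDr; apply: near_idealM (cpoly_A i) _.
    exact: near_ideal_socle i12 ib.
  rewrite mulrA -exprS; apply: sqspan_near.
  by rewrite mulrC; apply: near_idealM (cpoly_A _) (near_ideal_cube _).
- by rewrite expr1n mulr1; apply: sqspan_A.
- have [->|ia] := eqVneq i a.
    by rewrite -exprS; apply/sqspan_near/near_ideal_cube.
  by rewrite mulrC; apply: sqspan_socle; rewrite eq_sym.
have [->|ia] := eqVneq i a; first by rewrite -expr2; apply: sqspan_A2.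
apply: (sqspan_eq (q := A i ^+ 2 + A a ^+ 2)); last first.
  by apply: sqspanD; apply: sqspan_A2.
by rewrite addrA (addrC (A i * A a)); apply: near_ideal_quadric.
Qed.

Inductive near_span : P -> Prop :=
| near_span_basis (l : label) : z \notin l.1 -> near_span (basis_mono l)
| near_span_near p : near_ideal p -> near_span p
| near_spanD p q : near_span p -> near_span q -> near_span (p + q).

Lemma near_span_sq (T : {set 'I_n}) p :
  z \notin T -> sqspan p -> near_span ((\prod_(a in T) 'X_a) * p).
Proof.
move=> zT; elim=> [u|q Jq|q r _ IHq _ IHr]; last by rewrite mulrDr; apply: near_spanD.
  exact: (@near_span_basis (T, u)).
exact/near_span_near/near_idealM/Jq/cpoly_prodX.
Qed.

Lemma near_spanM i p : near_span p -> near_span ('X_i * p).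
Proof.
have other k q : k != z -> near_span q -> near_span ('X_k * q).
  move=> kz; elim=> [[T u] /= zT|r Jr|r r' _ IHr _ IHr'].
  - rewrite /basis_mono /=; have [kT|kT] := boolP (k \in T).
      rewrite (big_setD1 k) //= -mulrA mulrA -expr2 mulrCA.
      apply: near_span_sq; first by rewrite !inE negb_and zT orbT.
      by apply: sqspanM; apply: sqspan_core.
    rewrite mulrA -big_setU1 //; apply: near_span_sq; last exact: sqspan_core.
    by rewrite !inE negb_or eq_sym kz.
  - exact/near_span_near/near_idealM/Jr/cpoly_Xi.
  by rewrite mulrDr; apply: near_spanD.
move=> Sp; have [->|iz] := eqVneq i z; last exact: other.
have -> : 'X_z * p = \sum_(k | k != z) 'X_k * p + p * s.
  have -> : s = 'X_z + \sum_(k | k != z) 'X_k by rewrite /sumX (bigD1 z).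
  rewrite -mulr_suml; move: 'X_z (\sum_(k | _) _) => x y.
  by apply: (eq_char2 two0 (r := - (y * p))); ring.
apply: near_spanD.
  apply: big_ind => [|q r|k kz]; [|exact: near_spanD|exact: other].
  exact/near_span_near/near_ideal_of/kernel_ideal0.
apply/near_span_near/near_ideal_of/kernel_idealM.
exact/kernel_ideal_gen/kernel_gen_sum.
Qed.

Lemma near_spanX m : near_span 'X_[m].
Proof.
rewrite mpolyXE_id; elim/big_rec: _ => [|i p _ Sp].
  have := near_span_sq (T := set0) _ sqspan_one.
  by rewrite big_set0 mulr1 inE; apply.
by elim: (m i) => [|e IHe]; rewrite ?mul1r // exprS -mulrA; apply: near_spanM.
Qed.

Definition basis_deg (l : {set 'I_n} * (bool * 'I_n)) : nat :=
  #|l.1| + core_deg l.2 * 2.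

Definition basis_index d (l : {set 'I_n} * (bool * 'I_n)) : bool :=
  (z \notin l.1) && (basis_deg l == d).

Lemma basis_mono_homog l : basis_mono l \is (basis_deg l).-homog.
Proof.
have X1 i : ('X_i : P) \is 1.-homog by rewrite dhomogX /= mdeg1.
apply: dhomogM.
  rewrite -sum1_card; apply: (big_ind2 (fun (p : P) d => p \is d.-homog)) => //.
    exact: dhomog1.
  by move=> p d q e; apply: dhomogM.
apply: dhomogMn; rewrite /core_mono /core_deg.
case: ifP => _; case: ifP => _ //; last exact: (dhomogMn 2 (X1 _)).
- exact: (dhomogM (dhomogMn 2 (X1 i1)) (X1 i2)).
exact: dhomog1.
Qed.

Lemma near_span_combination p : near_span p -> exists f : label -> K,
  near_ideal (p - \sum_(l : label | z \notin l.1) f l *: basis_mono l).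
Proof.
elim=> [l zl|q Jq|q r _ [b Jb] _ [b' Jb']].
- exists (fun l' => (l' == l)%:R); rewrite (bigD1 l) //= eqxx scale1r.
  rewrite big1 => [|l' /andP[_ /negPf ->]]; last by rewrite scale0r.
  by rewrite addr0 subrr; exact/near_ideal_of/kernel_ideal0.
- exists (fun=> 0); rewrite big1 ?subr0 // => l _; exact: scale0r.
exists (fun l => b l + b' l).
under eq_bigr do rewrite scalerDl.
by rewrite big_split /= opprD addrACA; apply: near_idealD.
Qed.

Lemma cpoly_pihomog e d p : cpoly e p -> cpoly e (pihomog mdeg d p).
Proof.
move=> Vp; rewrite pihomogE; apply: cpoly_sum => m _.
by rewrite -[e]addn0; apply: cpolyZ (Vp m) (cpolyX _ _ _).
Qed.

Definition spanned d p : Prop := exists f : label -> K,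
  kernel_ideal c (p - \sum_(l | basis_index d l) f l *: basis_mono l).

Lemma spannedD d p q : spanned d p -> spanned d q -> spanned d (p + q).
Proof.
move=> [b Jb] [b' Jb']; exists (fun l => b l + b' l).
under eq_bigr do rewrite scalerDl.
by rewrite big_split /= opprD addrACA; apply: kernel_idealD.
Qed.

Lemma spannedZ d (u : K) p : spanned d p -> spanned d (u *: p).
Proof.
move=> [b Jb]; exists (fun l => u * b l).
under eq_bigr do rewrite -scalerA.
by rewrite -scaler_sumr -scalerBr; apply: kernel_idealZ.
Qed.

Lemma spanned_sum d (I : Type) (r : seq I) (B : pred I) (f : I -> P) :
  (forall x, B x -> spanned d (f x)) -> spanned d (\sum_(x <- r | B x) f x).
Proof.
move=> Sf; apply: big_ind => //; last exact: spannedD.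
exists (fun=> 0); rewrite big1 ?subr0 => [|l _]; last exact: scale0r.
exact: kernel_ideal0.
Qed.

(** This is near_spanX in degree d: taking homogeneous parts preserves the
    ideal and the divisibility of the error by c. *)
Lemma near_spanned d m : exists o : 'X_{1..n < d.+1} -> {poly F},
  spanned d (pihomog mdeg d 'X_[m] -
    c *: \sum_m' evc iota c (o m') *: pihomog mdeg d 'X_[m']).
Proof.
have [b [j [v [Jj Vv def_m]]]] := near_span_combination (near_spanX m).
pose v' := pihomog mdeg d v.
have Vv' : cpoly 1 v' by apply: cpoly_pihomog.
have [o v'o] : exists o : 'X_{1..n < d.+1} -> {poly F},
    forall m' : 'X_{1..n < d.+1}, v'@_m' = c * evc iota c (o m').
  by apply: (fin_all_exists (fun m' : 'X_{1..n < d.+1} => Vv' m')).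
exists o; exists b.
have homog_v' : v' \is d.-homog by apply: pihomogP.
have v'E : v' = c *: \sum_m' evc iota c (o m') *: pihomog mdeg d 'X_[m'].
  rewrite -[LHS](pihomog_dE homog_v') [v' in LHS](mpolywE (k := d.+1)).
    rewrite linear_sum scaler_sumr; apply: eq_bigr => m' _.
    by rewrite linearZ /= v'o scalerA.
  by rewrite msizeE; apply/bigmax_leqP_seq => m' /(dhomog_mf homog_v') /= ->.
rewrite -v'E.
have -> : \sum_(l | basis_index d l) b l *: basis_mono l =
    pihomog mdeg d (\sum_(l : label | z \notin l.1) b l *: basis_mono l).
  rewrite [RHS](linear_sum (pihomog mdeg d)) /=.
  rewrite [RHS](bigID (fun l => basis_deg l == d)) /=.
  rewrite [X in _ = _ + X]big1.
    rewrite addr0; apply: eq_bigr => l /andP[_ /eqP ld].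
    by rewrite linearZ /= pihomog_dE // -ld; apply: basis_mono_homog.
  move=> l /andP[_ ld]; rewrite linearZ /= (pihomog_ne0 ld) ?scaler0 //.
  exact: basis_mono_homog.
rewrite addrAC -linearB /= def_m linearD /= addrK.
exact: kernel_ideal_pihomog.
Qed.

(** The errors are absorbed by inverting a matrix that is the identity at
    c = 0. *)
Lemma homog_spanned d p :
  ~ algebraicOver iota c -> p \is d.-homog -> spanned d p.
Proof.
move=> ctr homp; pose I := 'X_{1..n < d.+1}; pose y (m : I) : P := pihomog mdeg d 'X_[m].
suff Sy m : spanned d (y m).
  rewrite -(pihomog_dE homp) [p](mpolywE (k := d.+1)); last first.
    by rewrite msizeE; apply/bigmax_leqP_seq => m' /(dhomog_mf homp) /= ->.
  rewrite linear_sum; apply: spanned_sum => m' _.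
  by rewrite linearZ; apply: spannedZ; apply: Sy.
have [o So] := choice (fun m : I => near_spanned d m).
pose R (m m' : I) : {poly F} := (m == m')%:R - 'X * o m m'.
have [b R0|S SR] := left_inverse_transcendental (R := R) ctr.
  have R0E (i k : I) : (R i k).[0] = (i == k)%:R.
    by rewrite /R hornerD hornerN hornerM hornerX mul0r subr0 -polyC_natr hornerC.
  move=> j; have := R0 j; rewrite (bigD1 j) //= big1 => [|k neq].
    by rewrite addr0 R0E eqxx mul1r.
  by rewrite R0E eq_sym (negPf neq) mul0r.
have -> : y m = \sum_j S m j *: (y j - c *: \sum_k evc iota c (o j k) *: y k).
  transitivity (\sum_j S m j *: \sum_k evc iota c (R j k) *: y k).
    have row (k : I) : \sum_j S m j *: (evc iota c (R j k) *: y k) = (m == k)%:R *: y k.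
      by rewrite -SR scaler_suml; apply: eq_bigr => j _; rewrite scalerA.
    under eq_bigr do rewrite scaler_sumr.
    rewrite exchange_big /= (bigD1 m) //= row eqxx scale1r big1 ?addr0 // => k neq.
    by rewrite row eq_sym (negPf neq) scale0r.
  apply: eq_bigr => j _; congr (_ *: _).
  under eq_bigr do rewrite /R rmorphB rmorphM rmorph_nat /= evcX scalerBl.
  rewrite sumrB (bigD1 j) //= eqxx scale1r big1 => [|k neq]; last first.
    by rewrite eq_sym (negPf neq) scale0r.
  by rewrite addr0 scaler_sumr; under [in RHS]eq_bigr do rewrite scalerA.
by apply: spanned_sum => j _; apply: spannedZ; apply: So.
Qed.

End Spanning.

(** * The basis monomials are independent modulo the kernel *)

Section Pairing.
Variables (F K : fieldType) (iota : {rmorphism F -> K}) (n : nat) (c : K).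
Hypotheses (charK : 2%N \in [pchar K]) (n_odd : odd n).
Variables (z i1 i2 : 'I_n).
Hypotheses (z1 : i1 != z) (z2 : i2 != z) (i12 : i1 != i2).
Local Notation P := {mpoly K[n]}.
Local Notation s := (sumX K n).
Local Notation h := (hspace K n).
Local Notation label := ({set 'I_n} * (bool * 'I_n))%type.
Local Notation cpoly := (@cpoly F K iota c n).
Implicit Types (p q r : P) (i j k a b : 'I_n).

Let two0 := mpoly_two0 n charK.

(** The vectors y_a - y_z with a != z form a basis of h, dual to the variables
    x_a in the quotient by s; accordingly the Dunkl operator splits into the
    derivation dderiv a, dual to x_a, and c times drefl a. *)
Definition diffv a : 'rV[K]_n := yv K a - yv K z.
Definition ddunkl a p : P := dunklv 1 c (diffv a) p.
Definition dderiv a p : P := p^`M(a) + p^`M(z).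
Definition drefl a p : P := reflsum a p + reflsum z p.

Lemma diffv_h a : diffv a \in h.
Proof. by apply: memv_span; apply/imageP; exists (a, z). Qed.

Lemma dunklv_yv i p : dunklv 1 c (yv K i) p = dunkl 1 c i p.
Proof.
rewrite /dunklv (bigD1 i) //= mxE !eqxx scale1r big1 ?addr0 // => j neq.
by rewrite mxE (negPf neq) andbF scale0r.
Qed.

Lemma ddunklE a p : ddunkl a p = dderiv a p + c *: drefl a p.
Proof.
transitivity (dunkl 1 c a p - dunkl 1 c z p).
  rewrite -!dunklv_yv /ddunkl /dunklv -sumrB; apply: eq_bigr => i _.
  by rewrite -scalerBl !mxE.
rewrite !dunkl_char2 // mpoly_oppr // /dderiv /drefl scalerDr.
exact: addrACA.
Qed.

Lemma ddunkl_linear a (u : K) p q :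
  ddunkl a (u *: p + q) = u *: ddunkl a p + ddunkl a q.
Proof. exact: dunklv_is_linear. Qed.

Lemma ddunklD a p q : ddunkl a (p + q) = ddunkl a p + ddunkl a q.
Proof. exact: (linearD (dunklv 1 c (diffv a))). Qed.

Lemma ddunklZ a (u : K) p : ddunkl a (u *: p) = u *: ddunkl a p.
Proof. exact: (linearZ_LR (dunklv 1 c (diffv a))). Qed.

Lemma dreflD a p q : drefl a (p + q) = drefl a p + drefl a q.
Proof. by rewrite /drefl (reflsumD a p q) (reflsumD z p q); exact: addrACA. Qed.

Lemma cpoly_reflsum e i p : cpoly e p -> cpoly e (reflsum i p).
Proof. by move=> Vp; apply: cpoly_sum => k neq; apply: cpoly_divdiff. Qed.

Lemma cpoly_drefl e a p : cpoly e p -> cpoly e (drefl a p).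
Proof. by move=> Vp; apply: cpolyD; apply: cpoly_reflsum. Qed.

Lemma cpoly_dderiv e a p : cpoly e p -> cpoly e (dderiv a p).
Proof. by move=> Vp; apply: cpolyD; apply: cpoly_mderiv. Qed.

Lemma cpolyWS e p : cpoly e.+1 p -> cpoly e p.
Proof. by rewrite -addn1; apply: cpolyW. Qed.

Lemma cpoly_ddunkl e a p : cpoly e p -> cpoly e (ddunkl a p).
Proof.
move=> Vp; rewrite ddunklE; apply: cpolyD; first exact: cpoly_dderiv.
exact/cpolyWS/cpolyZc/cpoly_drefl.
Qed.

Lemma mderiv_mderiv i p : p^`M(i)^`M(i) = 0.
Proof.
apply/mpolyP => m; rewrite !mcoeff_mderiv mcoeff0 mnmDE mnm1E eqxx addn1.
rewrite -mulrnA -mulr_natr.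
have : (2 %| (m i).+2 * (m i).+1)%N by rewrite dvdn2 oddM /= negbK andbN.
by move=> /dvdnP[e ->]; rewrite natrM (pcharf0 charK) !mulr0.
Qed.

Lemma dderiv_dderiv a p : dderiv a (dderiv a p) = 0.
Proof.
rewrite /dderiv !mderivD !mderiv_mderiv add0r addr0 mderiv_comm.
exact: mpoly_addpp.
Qed.

Lemma dderivD a p q : dderiv a (p + q) = dderiv a p + dderiv a q.
Proof. by rewrite /dderiv !mderivD addrACA. Qed.

Lemma dderivZ a (u : K) p : dderiv a (u *: p) = u *: dderiv a p.
Proof. by rewrite /dderiv !mderivZ scalerDr. Qed.

Lemma dderiv_sum a (I : Type) (r : seq I) (B : pred I) (f : I -> P) :
  dderiv a (\sum_(x <- r | B x) f x) = \sum_(x <- r | B x) dderiv a (f x).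
Proof. by rewrite /dderiv !raddf_sum -big_split. Qed.

Lemma dderivM a p q : dderiv a (p * q) = dderiv a p * q + p * dderiv a q.
Proof.
rewrite /dderiv !mderivM; move: (p^`M(a)) (p^`M(z)) (q^`M(a)) (q^`M(z)).
by move=> u v u' v'; ring.
Qed.

Lemma dderiv_sqr a p : dderiv a (p ^+ 2) = 0.
Proof. by rewrite /dderiv !mderiv_sqr // addr0. Qed.

(** The derivation part of the operator squares to zero, which is why its
    square is divisible by c. *)
Lemma ddunkl2E a p : ddunkl a (ddunkl a p) =
  c *: (dderiv a (drefl a p) + drefl a (ddunkl a p)).
Proof.
rewrite (ddunklE a (ddunkl a p)) {1}(ddunklE a p) dderivD dderiv_dderiv add0r.
by rewrite dderivZ -scalerDr.
Qed.

Lemma cpoly_ddunkl2 e a p : cpoly e p -> cpoly e.+1 (ddunkl a (ddunkl a p)).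
Proof.
move=> Vp; rewrite ddunkl2E; apply: cpolyZc; apply: cpolyD.
  exact/cpoly_dderiv/cpoly_drefl.
exact/cpoly_drefl/cpoly_ddunkl.
Qed.

Lemma divdiff_sqr i k p : k != i ->
  divdiff i k (p ^+ 2) = ('X_i - 'X_k) * divdiff i k p ^+ 2.
Proof.
move=> neq; apply: divdiff_eq => //; rewrite [msym _ _](rmorphXn (msym _)) /=.
have := divdiffE i k p; set d := divdiff i k p; set p' := msym _ p.
move: 'X_i 'X_k d p' => x y d p' e.
transitivity (((x - y) * d) ^+ 2); first by ring.
by rewrite e; apply: (eq_char2 two0 (r := p' ^+ 2 - p * p')); ring.
Qed.

(** The divided difference of a square vanishes along the reflection, and
    differentiating the linear factor leaves the square of the divided
    difference: at first order in c the square of a Dunkl operator acts on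
    squares as the operator with t = 0. *)
Lemma dderiv_drefl_sqr a p : a != z ->
  dderiv a (drefl a (p ^+ 2)) = drefl a p ^+ 2.
Proof.
move=> az; have za : z != a by rewrite eq_sym.
have dX i : dderiv a 'X_i = (i == a)%:R + (i == z)%:R.
  by rewrite /dderiv !mderivXi.
have term i k : k != i -> dderiv a (divdiff i k (p ^+ 2)) =
    (dderiv a 'X_i + dderiv a 'X_k) * divdiff i k p ^+ 2.
  move=> neq; rewrite divdiff_sqr // dderivM dderiv_sqr mulr0 addr0.
  by rewrite (mpoly_oppr charK 'X_k) dderivD.
have split i k : i != k -> dderiv a 'X_i = 1 -> dderiv a 'X_k = 1 ->
    (forall j, j != i -> j != k -> dderiv a 'X_j = 0) ->
    dderiv a (reflsum i (p ^+ 2)) =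
    reflsum i p ^+ 2 + divdiff i k p ^+ 2.
  move=> neq di dk dj; have ki : k != i by rewrite eq_sym.
  have -> : dderiv a (reflsum i (p ^+ 2)) =
      \sum_(j | (j != i) && (j != k)) divdiff i j p ^+ 2.
    rewrite /reflsum (bigD1 k) //= dderivD (term i k ki) di dk.
    rewrite (_ : 1 + 1 = 0) ?mul0r ?add0r; last exact: two0.
    rewrite dderiv_sum; apply: eq_bigr => j /andP[ji jk].
    by rewrite (term i j ji) di (dj j ji jk) addr0 mul1r.
  have -> : reflsum i p ^+ 2 = divdiff i k p ^+ 2 +
      \sum_(j | (j != i) && (j != k)) divdiff i j p ^+ 2.
    by rewrite /reflsum mpoly_sqr_sum // (bigD1 k).
  by rewrite addrAC mpoly_addpp // add0r.
have da : dderiv a 'X_a = 1 by rewrite dX eqxx (negPf az) addr0.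
have dz : dderiv a 'X_z = 1 by rewrite dX eqxx (negPf za) add0r.
have dj j : j != a -> j != z -> dderiv a 'X_j = 0.
  by move=> ja jz; rewrite dX (negPf ja) (negPf jz) addr0.
have Ea := split a z az da dz dj.
have Ez := split z a za dz da (fun j jz ja => dj j ja jz).
rewrite {1}/drefl dderivD; apply: (etrans (f_equal2 +%R Ea Ez)).
rewrite (divdiffC p za) sqrrN /drefl.
move: (reflsum a p) (reflsum z p) (divdiff a z p) => x y d.
by apply: (eq_char2 two0 (r := d ^+ 2 - x * y)); ring.
Qed.

(** One step of the computation of a product of squares of Dunkl operators on a
    square, keeping the leading coefficient in c only. *)
Lemma ddunkl2_sqr e a p q : a != z -> cpoly 0 p ->
    cpoly e.+1 (q - c ^+ e *: p ^+ 2) ->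
  cpoly e.+2 (ddunkl a (ddunkl a q) - c ^+ e.+1 *: drefl a p ^+ 2).
Proof.
move=> az Vp Vq; set v := q - _ in Vq.
have -> : q = c ^+ e *: p ^+ 2 + v by rewrite /v addrC subrK.
rewrite !ddunkl_linear addrAC; apply: cpolyD; last exact: cpoly_ddunkl2.
rewrite (exprSr c e) -scalerA -scalerBr.
have -> : ddunkl a (ddunkl a (p ^+ 2)) - c *: drefl a p ^+ 2 =
    c *: (c *: drefl a (drefl a (p ^+ 2))).
  rewrite ddunkl2E dderiv_drefl_sqr // scalerDr addrAC subrr add0r.
  rewrite [ddunkl a _]ddunklE dderiv_sqr add0r; congr (_ *: _).
  by rewrite /drefl !reflsumZ scalerDr.
have : cpoly 0 (drefl a (drefl a (p ^+ 2))).
  by do 2!apply: cpoly_drefl; apply: cpoly_exp.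
move=> /cpolyZc/cpolyZc V2 m; rewrite mcoeffZ.
have := V2 m; move=> [r ->]; exists r.
by rewrite mulrA -exprD addn2.
Qed.

Lemma cpoly_foldr_drefl p (w : seq 'I_n) : cpoly 0 p -> cpoly 0 (foldr drefl p w).
Proof. by move=> Vp; elim: w => //= a w; apply: cpoly_drefl. Qed.

Definition doubled (w : seq 'I_n) := flatten [seq [:: a; a] | a <- w].

Lemma foldr_ddunkl2_sqr p (w : seq 'I_n) : z \notin w -> cpoly 0 p ->
  cpoly (size w).+1
    (foldr ddunkl (p ^+ 2) (doubled w) - c ^+ size w *: foldr drefl p w ^+ 2).
Proof.
move=> + Vp; elim: w => [_|a w IHw] /=.
  by rewrite expr0 scale1r subrr; apply: cpoly0.
rewrite inE negb_or => /andP[za zw]; apply: ddunkl2_sqr (IHw zw).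
  by rewrite eq_sym.
exact: cpoly_foldr_drefl.
Qed.

Lemma cpoly_foldr_ddunkl2 e p (w : seq 'I_n) :
  cpoly e p -> cpoly (size w + e) (foldr ddunkl p (doubled w)).
Proof. by move=> Vp; elim: w => //= a w; apply: cpoly_ddunkl2. Qed.

(** n - 1 is even. *)
Lemma sum1_neq i : \sum_(k | k != i) 1 = 0 :> P.
Proof.
have : \sum_(k < n) 1 = 1 :> P by rewrite sumr_const card_ord natr_n.
rewrite (bigD1 i) //= => /eqP; rewrite -subr_eq0 addrAC subrr add0r.
by move=> /eqP.
Qed.

Lemma reflsumXi i j : reflsum i 'X_j = (j != i)%:R :> P.
Proof.
have [->|neq] := eqVneq j i.
  rewrite -[RHS](sum1_neq i); apply: eq_bigr => k ki.
  by rewrite divdiffXi // eqxx eq_sym (negPf ki) subr0.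
rewrite /reflsum (bigD1 j) //= divdiffXi // eqxx (negPf neq) sub0r.
rewrite mpoly_oppr // big1 ?addr0 // => k /andP[ki kj].
by rewrite divdiffXi // (negPf neq) eq_sym (negPf kj) subrr.
Qed.

Lemma dreflXi a j : drefl a 'X_j = (j != a)%:R + (j != z)%:R :> P.
Proof. by rewrite /drefl !reflsumXi. Qed.

Lemma drefl_sM a p : drefl a (s * p) = s * drefl a p.
Proof.
have refl_sM i : reflsum i (s * p) = s * reflsum i p.
  rewrite /reflsum mulr_sumr; apply: eq_bigr => k neq.
  by rewrite divdiffM // (divdiff_sym neq (msym_sumX K _)) mul0r addr0.
by rewrite /drefl !refl_sM mulrDr.
Qed.

Lemma drefl1 a : drefl a 1 = 0.
Proof. by rewrite /drefl !reflsum_sym ?addr0 // => w; apply: msym1. Qed.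

Lemma drefl_s a : drefl a s = 0.
Proof. by rewrite -[s]mulr1 drefl_sM drefl1 mulr0. Qed.

Lemma sum_addX i : \sum_(k | k != i) ('X_i + 'X_k) = 'X_i + s :> P.
Proof.
transitivity (\sum_k ('X_i + 'X_k) : P).
  by rewrite [RHS](bigD1 i) //= mpoly_addpp // add0r.
by rewrite big_split /= sumr_const card_ord -mulr_natl natr_n // mul1r.
Qed.

Lemma divdiffX2 i k : k != i -> divdiff i k ('X_i ^+ 2) = 'X_i + 'X_k :> P.
Proof.
move=> neq; apply: divdiff_eq; rewrite // [msym _ _](rmorphXn (msym _)) /=.
by rewrite msymXi tpermL; ring.
Qed.

Lemma divdiffX2' i j k : k != i -> j != i -> divdiff i k ('X_j ^+ 2) =
  if k == j then 'X_i + 'X_j else 0 :> P.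
Proof.
move=> ki ji; have [->|kj] := eqVneq k j; last first.
  apply: divdiff_sym; rewrite // [msym _ _](rmorphXn (msym _)) /= msymXi.
  by rewrite tpermD // eq_sym.
apply: divdiff_eq; rewrite // [msym _ _](rmorphXn (msym _)) /= msymXi tpermR.
by apply: (eq_char2 two0 (r := 'X_i ^+ 2 - 'X_j ^+ 2)); ring.
Qed.

Lemma reflsumX2 i : reflsum i ('X_i ^+ 2) = 'X_i + s :> P.
Proof. by rewrite -sum_addX; apply: eq_bigr => k; apply: divdiffX2. Qed.

Lemma reflsumX2' i j : j != i -> reflsum i ('X_j ^+ 2) = 'X_i + 'X_j :> P.
Proof.
move=> ji; rewrite /reflsum (bigD1 j) //= divdiffX2' // eqxx big1 ?addr0 //.
by move=> k /andP[ki kj]; rewrite divdiffX2' // (negPf kj).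
Qed.

Lemma drefl2X2 a b : a != z -> b != z ->
  drefl a (drefl a ('X_b ^+ 2)) = (a == b)%:R.
Proof.
move=> az bz; have za : z != a by rewrite eq_sym.
have [<-|ab] := eqVneq a b.
  have -> : drefl a ('X_a ^+ 2) = s + 'X_z.
    rewrite /drefl reflsumX2 reflsumX2' //.
    by move: 'X_a 'X_z s => x y w; apply: (eq_char2 two0 (r := x)); ring.
  by rewrite dreflD drefl_s dreflXi za eqxx addr0 add0r.
have -> : drefl a ('X_b ^+ 2) = 'X_a + 'X_z.
  rewrite /drefl !reflsumX2' //; last by rewrite eq_sym.
  by move: 'X_a 'X_z 'X_b => x y w; apply: (eq_char2 two0 (r := w)); ring.
by rewrite dreflD !dreflXi za az !eqxx addr0 add0r mpoly_addpp.
Qed.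

Lemma reflsumXX i j : j != i -> reflsum i ('X_i * 'X_j) = 'X_j :> P.
Proof.
move=> ji; rewrite /reflsum (bigD1 j) //= divdiff_sym //; last first.
  by rewrite msymM !msymXi tpermL tpermR mulrC.
have count : \sum_(k | (k != i) && (k != j)) 1 = 1 :> P.
  have := sum1_neq i; rewrite (bigD1 j) //= => /eqP.
  by rewrite addrC addr_eq0 mpoly_oppr // => /eqP.
rewrite add0r -[RHS]mulr1 -[in RHS]count mulr_sumr.
apply: eq_bigr => k /andP[ki kj].
have ij : i != j by rewrite eq_sym.
by apply: divdiff_eq; rewrite // msymM !msymXi tpermL tpermD // mulr1 mulrBl.
Qed.

(** The form with t = 0 does not vanish on the socle of the core. *)
Lemma drefl_socle : drefl i2 (drefl i2 (drefl i1 ('X_i1 ^+ 2 * 'X_i2))) = 1.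
Proof.
have [zi1 zi2 i21] : [/\ z != i1, z != i2 & i2 != i1] by split; rewrite eq_sym.
have at_i1 : reflsum i1 ('X_i1 ^+ 2 * 'X_i2) = s * 'X_i2 + 'X_i2 ^+ 2 + 'X_i1 * 'X_i2.
  rewrite /reflsum (bigD1 i2) //=.
  rewrite (@divdiff_eq _ _ _ _ _ ('X_i1 * 'X_i2)) //; last first.
    by rewrite msymM [msym _ (_ ^+ 2)](rmorphXn (msym _)) /= !msymXi tpermL tpermR; ring.
  rewrite (eq_bigr (fun k => 'X_i2 * ('X_i1 + 'X_k))) => [|k /andP[k1 k2]]; last first.
    apply: divdiff_eq; rewrite // msymM [msym _ (_ ^+ 2)](rmorphXn (msym _)) /=.
    by rewrite !msymXi tpermL tpermD //; ring.
  rewrite -mulr_sumr.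
  have -> : \sum_(k | (k != i1) && (k != i2)) ('X_i1 + 'X_k) = s + 'X_i2 :> P.
    have := sum_addX i1; rewrite (bigD1 i2) //= => /(canRL (addKr _)) ->.
    move: 'X_i1 'X_i2 s => x y w.
    by apply: (eq_char2 two0 (r := - y)); ring.
  move: 'X_i1 'X_i2 s => x y w; ring.
have at_z : reflsum z ('X_i1 ^+ 2 * 'X_i2) =
    'X_i2 * ('X_z + 'X_i1) + 'X_i1 ^+ 2 :> P.
  rewrite /reflsum (bigD1 i1) //= (bigD1 i2) /=; last by rewrite i21 andbT.
  rewrite [X in _ + (_ + X)]big1 => [|k /andP[/andP[kz k1] k2]]; last first.
    apply: divdiff_sym => //.
    by rewrite msymM [msym _ (_ ^+ 2)](rmorphXn (msym _)) /= !msymXi !tpermD.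
  rewrite [X in _ + X]addr0.
  congr (_ + _); apply: divdiff_eq => //;
    rewrite msymM [msym _ (_ ^+ 2)](rmorphXn (msym _)) /= !msymXi.
    rewrite tpermR tpermD //; move: 'X_i1 'X_i2 'X_z => x y w.
    by apply: (eq_char2 two0 (r := y * w ^+ 2 - y * x ^+ 2)); ring.
  rewrite tpermR tpermD //; move: 'X_i1 'X_i2 'X_z => x y w.
  by apply: (eq_char2 two0 (r := x ^+ 2 * w - x ^+ 2 * y)); ring.
have -> : drefl i1 ('X_i1 ^+ 2 * 'X_i2) =
    s * 'X_i2 + 'X_i2 ^+ 2 + 'X_i1 ^+ 2 + 'X_i2 * 'X_z.
  rewrite /drefl at_i1 at_z; move: 'X_i1 'X_i2 'X_z s => x y w v.
  by apply: (eq_char2 two0 (r := x * y)); ring.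
have e1 : drefl i2 (drefl i2 (s * 'X_i2)) = 0.
  by rewrite drefl_sM dreflXi eqxx z2 add0r -[s * 1]/(s * 1) mulr1 drefl_s.
have e4 : drefl i2 (drefl i2 ('X_i2 * 'X_z : P)) = 0.
  have -> : drefl i2 ('X_i2 * 'X_z) = 'X_z + 'X_i2 :> P.
    by rewrite /drefl reflsumXX // ['X_i2 * _]mulrC reflsumXX.
  by rewrite dreflD !dreflXi zi2 z2 !eqxx addr0 add0r mpoly_addpp.
have e2 := drefl2X2 z2 z2; have e3 := drefl2X2 z2 z1.
have dist (d : P -> P) : (forall p q, d (p + q) = d p + d q) ->
    forall p q r v, d (d (p + q + r + v)) = d (d p) + d (d q) + d (d r) + d (d v).
  by move=> dD p q r v; rewrite !dD.
apply: (etrans (dist _ (dreflD i2) _ _ _ _)).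
apply: (etrans (f_equal2 +%R (f_equal2 +%R (f_equal2 +%R e1 e2) e3) e4)).
by rewrite eqxx (negPf i21) !addr0 add0r.
Qed.

(** Words in the operators with t = 0 that form the dual basis of the core
    monomials in each degree. *)
Definition dual_word (u : bool * 'I_n) : seq 'I_n :=
  if u.2 == z then if u.1 then [:: i2; i2; i1] else [::]
  else if u.1 then [:: u.2; u.2] else [:: u.2].

Lemma size_dual_word u : size (dual_word u) = core_deg z u.
Proof. by rewrite /dual_word /core_deg; do 2!case: ifP. Qed.

Lemma dual_word_z u : z \notin dual_word u.
Proof.
rewrite /dual_word; have [_|uz] := eqVneq u.2 z; case: u.1 => //=;
  by rewrite !inE eq_sym ?negb_or -?(eq_sym z) ?(eq_sym z) ?uz ?z1 ?z2.
Qed.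

Local Notation core := (core_mono K z i1 i2).

Lemma drefl_core_mono u v : core_deg z u = core_deg z v ->
  foldr drefl (core v) (dual_word u) = (u == v)%:R.
Proof.
case: u v => [[] a] [[] b]; rewrite /core_deg /core_mono /dual_word ?xpair_eqE /=;
  case: (eqVneq a z) => [az|az]; case: (eqVneq b z) => [bz|bz] //= _.
all: rewrite ?az ?bz ?eqxx //.
- exact: drefl_socle.
- by rewrite drefl2X2.
- by rewrite dreflXi bz eq_sym; case: (a =P b); rewrite ?addr0 ?add0r // mpoly_addpp.
Qed.

Lemma dderiv_prod a (U : {set 'I_n}) : a != z -> z \notin U ->
  dderiv a (\prod_(i in U) 'X_i) =
  if a \in U then \prod_(i in U :\ a) 'X_i else 0 :> P.
Proof.
move=> az zU.
have const0 i (W : {set 'I_n}) : i \notin W -> (\prod_(j in W) 'X_j)^`M(i) = 0 :> P.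
  move=> iW; apply: (big_ind (fun p : P => p^`M(i) = 0)) => [|p q dp dq|j jW].
  - by rewrite -mpolyC1 mderivC.
  - by rewrite mderivM dp dq mul0r mulr0 addr0.
  by rewrite mderivXi; case: eqP iW => // <-; rewrite jW.
case: ifPn => aU; last by rewrite /dderiv !const0 ?addr0.
rewrite (big_setD1 a) //= dderivM /dderiv !const0 ?inE ?eqxx //; last first.
  by rewrite negb_and zU orbT.
by rewrite !mderivXi eqxx (negPf az) !addr0 mul1r mulr0 addr0.
Qed.

(** At order zero in c only the derivations remain, and they act on the
    square-free part alone. *)
Lemma foldr_ddunkl_prod (w : seq 'I_n) (T : {set 'I_n}) p :
    uniq w -> z \notin w -> z \notin T -> cpoly 0 p ->
  cpoly 1 (foldr ddunkl ((\prod_(i in T) 'X_i) * p ^+ 2) w -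
    if [set i in w] \subset T then
      (\prod_(i in T :\: [set i in w]) 'X_i) * p ^+ 2 else 0).
Proof.
move=> + + zT Vp; elim: w => [_ _|a w IHw] /=.
  have -> : [set i in [::]] = set0 :> {set 'I_n} by apply/setP => i; rewrite !inE.
  by rewrite sub0set setD0 subrr; apply: cpoly0.
rewrite inE negb_or => /andP[aw uw] /andP[za zw]; have az : a != z by rewrite eq_sym.
have {IHw} := IHw uw zw; set q := foldr _ _ w; set W := [set i in w].
set q' := (if _ then _ else _); move=> Vqq'.
have Wa : [set i in a :: w] = a |: W by apply/setP => i; rewrite !inE.
have Vq' : cpoly 0 q'.
  rewrite /q'; case: ifP => _; last exact: cpoly0.
  by apply: cpolyM0; [apply: cpoly_prodX | apply: cpoly_exp].
have dq' : dderiv a q' = if a |: W \subset T then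
    (\prod_(i in T :\: (a |: W)) 'X_i) * p ^+ 2 else 0.
  rewrite /q' subUset sub1set andbC; case: (W \subset T) => /=; last first.
    by rewrite /dderiv !mderiv0 addr0.
  have zTW : z \notin T :\: W by rewrite inE negb_and zT orbT.
  rewrite dderivM dderiv_sqr mulr0 addr0 (dderiv_prod az zTW).
  rewrite inE [a \in W]inE (negPf aw) /=; case: (a \in T); last by rewrite mul0r.
  by rewrite setDDl setUC.
have -> : q = (q - q') + q' by rewrite subrK.
rewrite Wa -dq' ddunklD (ddunklE a q') -addrA [X in _ + X]addrAC subrr add0r.
apply: cpolyD.
  exact: cpoly_ddunkl.
exact/cpolyZc/cpoly_drefl.
Qed.

(** The dual of a basis monomial: the Dunkl operators of its square-free part
    act first, then the squares of those dual to its core monomial. *)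
Definition pairing_word (l : label) : seq 'I_n :=
  doubled (dual_word l.2) ++ enum l.1.

Definition pairing (l k : label) : K :=
  (foldr ddunkl (basis_mono K z i1 i2 k) (pairing_word l))@_0%MM.

Lemma foldr_ddunklD p q (w : seq 'I_n) :
  foldr ddunkl (p + q) w = foldr ddunkl p w + foldr ddunkl q w.
Proof.
elim: w => [//|a w IHw].
exact: etrans (congr1 (ddunkl a) IHw) (ddunklD a (foldr ddunkl p w) _).
Qed.

Lemma cpoly_core u : cpoly 0 (core u).
Proof.
rewrite /core_mono; case: ifP => _; case: ifP => _; last exact: cpolyX.
- apply: cpolyM0; last exact: cpolyX.
  exact/cpoly_exp/cpolyX.
- exact: cpoly1.
exact/cpoly_exp/cpolyX.
Qed.

(** With rows divided by powers of c, the pairing matrix at c = 0 is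
    unitriangular with respect to the number of square-free variables. *)
Lemma pairing_expansion d (l k : label) : basis_index z d l -> basis_index z d k ->
  exists r : {poly F}, pairing l k = c ^+ core_deg z l.2 * evc iota c r /\
    ((#|k.1| <= #|l.1|)%N -> r.[0] = (l == k)%:R).
Proof.
case: l k => [S u] [T v] /andP[/= zS /eqP dS] /andP[/= zT /eqP dT].
rewrite /pairing /pairing_word /= foldr_cat /basis_mono /=.
have := foldr_ddunkl_prod (enum_uniq S) _ zT (cpoly_core v).
rewrite mem_enum => /(_ zS).
have -> : [set i in enum S] = S by apply/setP => i; rewrite inE mem_enum.
set q := foldr ddunkl _ _ => Vq; rewrite -(size_dual_word u).
set w := dual_word u; set w2 := doubled w.
have cadic_coeff e p : cpoly e p ->
    exists r : {poly F}, p@_0%MM = c ^+ e * evc iota c r by move=> Vp; apply: Vp.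
have [leTS|ltST] := leqP #|T| #|S|; last first.
  have Vq0 : cpoly 0 q.
    rewrite /q; elim: (enum S) => [|a w' IH] /=; last exact: cpoly_ddunkl.
    by apply: cpolyM0; [apply: cpoly_prodX | exact/cpoly_exp/cpoly_core].
  have [r ->] := cadic_coeff _ _ (cpoly_foldr_ddunkl2 w Vq0).
  by rewrite addn0; exists r.
have shift e (a : K) : (exists r : {poly F}, a = c ^+ (e + 1) * evc iota c r) ->
    exists r : {poly F}, a = c ^+ e * evc iota c r /\ r.[0] = 0.
  move=> [r ->]; exists ('X * r).
  by rewrite rmorphM /= evcX exprD mulrA hornerM hornerX mul0r.
have [eqST|neST] := eqVneq S T; last first.
  (* S is at least as large as T and different from it. *)
  have nST : S \subset T = false.
    by apply: contraNF neST => sST; rewrite eqEcard sST.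
  rewrite nST subr0 in Vq.
  have [r [rE r0]] := shift _ _ (cadic_coeff _ _ (cpoly_foldr_ddunkl2 w Vq)).
  exists r; split=> // _; rewrite r0.
  by rewrite xpair_eqE /= (negPf neST).
rewrite eqST subxx setDv big_set0 mul1r in Vq.
have eq_deg : core_deg z u = core_deg z v.
  move: dT; rewrite -dS /basis_deg /= eqST => /addnI/eqP.
  by rewrite eqn_pmul2r // => /eqP.
pose x := core v ^+ 2.
have Vv := cpoly_foldr_ddunkl2 w Vq.
have Vx := foldr_ddunkl2_sqr (dual_word_z u) (cpoly_core v).
have -> : foldr ddunkl q w2 = foldr ddunkl (q - x) w2 + foldr ddunkl x w2.
  by rewrite -foldr_ddunklD subrK.
rewrite mcoeffD.
have : cpoly (size w + 1) (foldr ddunkl (q - x) w2 +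
    (foldr ddunkl x w2 - c ^+ size w *: foldr drefl (core v) w ^+ 2)).
  by apply: cpolyD => //; rewrite addn1.
move=> /cadic_coeff /shift [r [rE r0]].
exists ((u == v)%:R + r); split=> [|_]; last first.
  by rewrite hornerD r0 addr0 -polyC_natr hornerC xpair_eqE /= eqST eqxx.
rewrite rmorphD rmorph_nat mulrDr -rE mcoeffD mcoeffB mcoeffZ.
rewrite (drefl_core_mono eq_deg) -natrX -mpolyC_nat mcoeffC eqxx.
have -> : ((u == v) ^ 2)%N = (u == v) by case: (u == v).
by rewrite mulr1 [RHS]addrCA [X in _ = _ + X]addrCA subrr addr0.
Qed.

Hypothesis c_transcendental : ~ algebraicOver iota c.

Lemma transcendental_neq0 : c != 0.
Proof. by apply/eqP => c0; apply: c_transcendental; rewrite c0; apply: algebraic0. Qed.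

Lemma foldr_ddunkl_sum (I : Type) (r : seq I) (B : pred I) (f : I -> K)
    (g : I -> P) (w : seq 'I_n) :
  foldr ddunkl (\sum_(x <- r | B x) f x *: g x) w =
  \sum_(x <- r | B x) f x *: foldr ddunkl (g x) w.
Proof.
elim: w => [//|a w IHw].
apply: (etrans (congr1 (ddunkl a) IHw)).
apply: (etrans (linear_sum (dunklv 1 c (diffv a)) _ _ _)).
by apply: eq_bigr => x _; apply: ddunklZ.
Qed.

Lemma foldr_diffv p (w : seq 'I_n) :
  foldr (dunklv 1 c) p [seq diffv a | a <- w] = foldr ddunkl p w.
Proof. by rewrite foldr_map. Qed.

Lemma ker_pairing0 (l : label) p : piA p \in ker_cform 1 c ->
  (foldr ddunkl p (pairing_word l))@_0%MM = 0.
Proof.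
move=> /asboolP ker_p; rewrite -foldr_diffv -cform_prod; first exact: ker_p.
by move=> v /mapP[a _ ->]; apply: diffv_h.
Qed.

Lemma basis_independent d (f : label -> K) :
    piA (\sum_(l | basis_index z d l) f l *: basis_mono K z i1 i2 l)
      \in ker_cform 1 c ->
  forall l, basis_index z d l -> f l = 0.
Proof.
move=> ker_f.
have R_ex (lk : label * label) : exists r : {poly F},
    basis_index z d lk.1 -> basis_index z d lk.2 ->
    pairing lk.1 lk.2 = c ^+ core_deg z lk.1.2 * evc iota c r /\
    ((#|lk.2.1| <= #|lk.1.1|)%N -> r.[0] = (lk.1 == lk.2)%:R).
  case: lk => [l k] /=.
  have [dl|/negPf dl] := boolP (basis_index z d l); last by exists 0.
  have [dk|/negPf dk] := boolP (basis_index z d k); last by exists 0.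
  by have [r rP] := pairing_expansion dl dk; exists r.
have [R RP] := choice R_ex.
pose M (l k : label) : {poly F} :=
  if basis_index z d l && basis_index z d k then R (l, k) else (l == k)%:R.
have [b Mb|S SM] := left_inverse_transcendental (R := M) c_transcendental.
  have bad l : ~~ basis_index z d l -> b l = 0.
    move=> dl; have := Mb l; rewrite (bigD1 l) //= big1 => [|k kl].
      by rewrite addr0 /M (negPf dl) eqxx -polyC_natr hornerC mul1r.
    by rewrite /M (negPf dl) eq_sym (negPf kl) -polyC_natr hornerC mul0r.
  (* Downward induction on the size of the square-free part. *)
  suff good N l : basis_index z d l -> (n - #|l.1| < N)%N -> b l = 0.
    move=> l; have [dl|] := boolP (basis_index z d l); last exact: bad.
    exact: (good _ l dl (leqnn _)).
  elim: N l => [//|N IHN] l dl ltN.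
  have := Mb l; rewrite (bigD1 l) //= big1 => [|k kl].
    by rewrite addr0 /M dl (RP (l, l) dl dl).2 //= eqxx mul1r.
  have [dk|dk] := boolP (basis_index z d k); last by rewrite bad ?mulr0.
  have [le|lt] := leqP #|k.1| #|l.1|.
    by rewrite /M dl dk (RP (l, k) dl dk).2 //= eq_sym (negPf kl) mul0r.
  rewrite (IHN k dk) ?mulr0 //; rewrite -ltnS; apply: leq_trans ltN.
  have kn : (#|k.1| <= n)%N by rewrite -[X in (_ <= X)%N](card_ord n) max_card.
  by rewrite ltnS ltn_sub2l // (leq_trans lt kn).
move=> l dl; pose f' (k : label) := if basis_index z d k then f k else 0.
have Mf (k : label) :
    \sum_j evc iota c (M k j) * f' j = (~~ basis_index z d k)%:R * f' k.
  have [dk|dk] := boolP (basis_index z d k); last first.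
    rewrite (bigD1 k) //= big1 => [|j jk].
      by rewrite addr0 /M (negPf dk) eqxx rmorph1.
    by rewrite /M (negPf dk) eq_sym (negPf jk) rmorph0 mul0r.
  rewrite mul0r; apply: (mulfI (expf_neq0 (core_deg z k.2) transcendental_neq0)).
  rewrite mulr0 -[RHS](ker_pairing0 k ker_f) foldr_ddunkl_sum raddf_sum /= mulr_sumr.
  rewrite [RHS]big_mkcond /=; apply: eq_bigr => j _; rewrite /f' /M dk /=.
  case: ifP => dj; last by rewrite !mulr0.
  rewrite mcoeffZ -/(pairing k j) (RP (k, j) dk dj).1 /= mulrC mulrAC.
  by rewrite [RHS]mulrC [X in X * _]mulrC.
have f'l : f' l = 0; last by move: f'l; rewrite /f' dl.
transitivity (\sum_k S l k * \sum_j evc iota c (M k j) * f' j).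
  have row (j : label) :
      \sum_k S l k * (evc iota c (M k j) * f' j) = (l == j)%:R * f' j.
    by rewrite -SM mulr_suml; apply: eq_bigr => k _; rewrite mulrA.
  under eq_bigr do rewrite mulr_sumr.
  rewrite exchange_big /= (bigD1 l) //= row eqxx mul1r big1 ?addr0 // => j jl.
  by rewrite row eq_sym (negPf jl) mul0r.
apply: big1 => k _; rewrite Mf /f'; case: ifP => dk; last by rewrite !mulr0.
by rewrite mul0r mulr0.
Qed.

End Pairing.

(** * The Hilbert series *)

Section HilbertSeries.
Variables (F K : fieldType) (iota : {rmorphism F -> K}) (n : nat) (c : K).
Hypotheses (charK : 2%N \in [pchar K]) (n_odd : odd n).
Variables (z i1 i2 : 'I_n).
Hypotheses (z1 : i1 != z) (z2 : i2 != z) (i12 : i1 != i2).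
Hypothesis c_transcendental : ~ algebraicOver iota c.
Local Notation P := {mpoly K[n]}.
Local Notation label := ({set 'I_n} * (bool * 'I_n))%type.
Local Notation basis := (basis_mono K z i1 i2).

Lemma hilbert_series_of_basis (H : {poly int}) :
    (forall d, H`_d = #|[pred l : label | basis_index z d l]|%:Z) ->
  is_hilbert_series (@degL K n 1 c) H.
Proof.
move=> HE d; exists #|[pred l : label | basis_index z d l]|; last exact: HE.
set A := [pred l | _].
have sumA (V : zmodType) (f : label -> V) :
    \sum_(k < #|A|) f (enum_val k) = \sum_(l | basis_index z d l) f l.
  by rewrite -(big_enum_val f).
exists (fun k => lpi (ker_cform 1 c) (piA (basis (enum_val k)))); split.
- move=> k; have /andP[_ /eqP dk] := enum_valP k.
  exists (piA (basis (enum_val k))) => //; exists (basis (enum_val k)) => //.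
  by rewrite -dk; apply: basis_mono_homog.
- move=> a; pose f l := \sum_(k < #|A| | enum_val k == l) a k.
  have fE k : f (enum_val k) = a k.
    rewrite /f (eq_bigl (eq_op^~ k)) ?big_pred1_eq // => j.
    by rewrite (inj_eq enum_val_inj).
  move=> suma0 k; rewrite -fE.
  apply: (basis_independent charK n_odd z1 z2 i12 c_transcendental (d := d));
    last by have := enum_valP k; rewrite inE.
  have lpi0 : lpi (ker_cform 1 c) (0 : polyA K n) = 0 by rewrite raddf0.
  rewrite -[piA _]subr0; apply/lpi_eq; rewrite lpi0 -suma0 -sumA.
  rewrite 2!linear_sum /=; apply: eq_bigr => j _.
  by rewrite 2!linearZ /= fE.
move=> x [_ [p homp ->] ->].
have [f Jf] := homog_spanned charK n_odd z i12 c_transcendental homp.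
exists (fun k => f (enum_val k)).
rewrite (eq_bigr (fun k =>
    lpi (ker_cform 1 c) (piA (f (enum_val k) *: basis (enum_val k))))).
  rewrite (sumA _ (fun l => lpi (ker_cform 1 c) (piA (f l *: basis l)))).
  rewrite -(linear_sum (lpi (ker_cform 1 c))) -(linear_sum (@piA K n)).
  apply/lpi_eq; rewrite -raddfB; exact: (kernel_ideal_ker charK n_odd Jf).
by move=> k _; rewrite 2!linearZ.
Qed.

Local Notation X := ('X : {poly int}).

Lemma sum_subsets : \sum_(T : {set 'I_n} | z \notin T) X ^+ #|T| = (1 + X) ^+ n.-1.
Proof.
have cardz : #|[set~ z]| = n.-1 by rewrite cardsC1 card_ord.
rewrite exprDn (eq_bigl (fun T : {set 'I_n} => T \subset [set~ z])); last first.
  by move=> T; rewrite subsetC sub1set inE.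
rewrite (partition_big (fun T : {set 'I_n} => inord #|T| : 'I_n.-1.+1) xpredT) //=.
apply: eq_bigr => k _; rewrite expr1n mul1r.
have in_k (T : {set 'I_n}) : T \subset [set~ z] ->
    (inord #|T| == k :> 'I_n.-1.+1) = (#|T| == k).
  move=> /subset_leq_card; rewrite cardz -ltnS => ltT.
  by rewrite -(inj_eq val_inj) /= inordK.
rewrite (eq_bigl (fun T : {set 'I_n} => (T \subset [set~ z]) && (#|T| == k))).
  rewrite (eq_bigr (fun=> X ^+ k)) => [|T /andP[_ /eqP ->]//].
  have -> : 'C(n.-1, k) =
      #|[set T : {set 'I_n} | T \subset [set~ z] & #|T| == k]|.
    by rewrite cards_draws cardz.
  rewrite sumr_const; congr (_ *+ _).
  by apply: eq_card => T; rewrite inE.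
by move=> T; have [sT|//] := boolP (T \subset _); rewrite in_k.
Qed.

Lemma sum_core : \sum_(u : bool * 'I_n) X ^+ (core_deg z u * 2) =
  1 + (n%:R - 1) * X ^+ 2 + (n%:R - 1) * X ^+ 4 + X ^+ 6.
Proof.
have n1 : n%:R - 1 = n.-1%:R :> {poly int}.
  by rewrite -subn1 natrB //; case: (n) z => // - [].
rewrite -(pair_bigA _ (fun b a => X ^+ (core_deg z (b, a) * 2))) big_bool /=.
have row (b : bool) : \sum_(a < n) X ^+ (core_deg z (b, a) * 2) =
    (if b then X ^+ 6 else 1) + (n%:R - 1) * (if b then X ^+ 4 else X ^+ 2).
  rewrite (bigD1 z) //= {1}/core_deg eqxx /=; congr (_ + _); first by case: b.
  rewrite (eq_bigr (fun=> if b then X ^+ 4 else X ^+ 2)) => [|a az]; last first.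
    by rewrite /core_deg /= (negPf az); case: b.
  by rewrite n1 sumr_const cardC1 card_ord -[LHS]mulr_natl.
by rewrite !row; ring.
Qed.

(** The square-free parts contribute (1 + X)^(n-1), the core monomials evaluated
    at squares the remaining factor. *)
Lemma coef_basis_count d : ((1 + X) ^+ n.-1 *
    (1 + (n%:R - 1) * X ^+ 2 + (n%:R - 1) * X ^+ 4 + X ^+ 6))`_d =
  #|[pred l : label | basis_index z d l]|%:Z.
Proof.
rewrite -sum_core -sum_subsets big_distrlr /= pair_big_dep /= coef_sum.
rewrite -natz -sum1_card natr_sum [RHS]big_mkcond [LHS]big_mkcond /=.
apply: eq_bigr => [[T u]] _ /=; rewrite andbT inE /basis_index /basis_deg /=.
case: (z \notin T) => //=; rewrite -exprD coefXn eq_sym.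
by case: eqP.
Qed.

End HilbertSeries.

Section PrimeField.
Variables (K : fieldType) (charK : 2%N \in [pchar K]).

(** The inclusion of the prime field, as a morphism into K itself rather than
    into the copy of K that carries the algebra structure. *)
Definition prime_field_map : 'F_2 -> K := in_alg (pPrimeCharType charK).

Lemma prime_field_map_zmod : zmod_morphism prime_field_map.
Proof. exact: (rmorphB (in_alg (pPrimeCharType charK))). Qed.
Lemma prime_field_map_monoid : monoid_morphism prime_field_map.
Proof.
split; first exact: (rmorph1 (in_alg (pPrimeCharType charK))).
exact: (rmorphM (in_alg (pPrimeCharType charK))).
Qed.
HB.instance Definition _ :=
  GRing.isZmodMorphism.Build 'F_2 K prime_field_map prime_field_map_zmod.
HB.instance Definition _ :=
  GRing.isMonoidMorphism.Build 'F_2 K prime_field_map prime_field_map_monoid.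
End PrimeField.

Theorem theorem3p17 (K : closedFieldType) (n : nat) (c : K)
    (charK : 2%N \in [pchar K]) (n_gt1 : (1 < n)%N) (n_odd : odd n)
    (c_transcendental : ~ algebraicOver (in_alg (pPrimeCharType charK)) c) :
  is_hilbert_series (@degL K n 1 c)
    ((1 + 'X^2) * (1 + 'X) ^+ n.-1 * (1 + (n%:R - 2%:R) * 'X^2 + 'X^4))
  /\
  is_hilbert_series (@degL K n 1 c)
    ((1 + 'X) ^+ n.-1 *
     (1 + (n%:R - 1) * 'X^2 + (n%:R - 1) * 'X^4 + 'X^6)).
Proof.
have n_gt2 : (2 < n)%N by case: n n_gt1 n_odd => [|[|[]]].
pose z : 'I_n := Ordinal (ltnW (ltnW n_gt2)).
pose i1 : 'I_n := Ordinal (ltnW n_gt2); pose i2 : 'I_n := Ordinal n_gt2.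
have H : is_hilbert_series (@degL K n 1 c) ((1 + 'X) ^+ n.-1 *
    (1 + (n%:R - 1) * 'X^2 + (n%:R - 1) * 'X^4 + 'X^6)).
  apply: (hilbert_series_of_basis (iota := prime_field_map charK) charK n_odd
    (z := z) (i1 := i1) (i2 := i2)) => // d.
  exact: coef_basis_count.
split=> //; rewrite (_ : _ * _ = (1 + 'X) ^+ n.-1 *
    (1 + (n%:R - 1) * 'X^2 + (n%:R - 1) * 'X^4 + 'X^6)) //.
by move: (_ ^+ n.-1) => Y; ring.
Qed.
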